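(* Let $\Bbbk$ be a field of characteristic $0$ and $c_1,c_2,\ldots\in\Bbbk$. The compositional inverse of $$C(x)=x+c_1x^2+c_2x^3+\cdots\quad\text{is}\quad C^{\langle-1\rangle}(x)=D(x)=x+d_1x^2+d_2x^3+\cdots,$$ where for each $n\ge1$ $$d_n=\sum_{F\text{ face of }\mathfrak a_n}(-1)^{n-\dim F}c_F,$$ the sum being over the nonempty faces $F$ of the associahedron $\mathfrak a_n$, and $c_F=c_{f_1}\cdots c_{f_k}$ for each face $F\cong\mathfrak a_{f_1}\times\cdots\times\mathfrak a_{f_k}$ of $\mathfrak a_n$.
   Context: For $J\subseteq\{1,\dots,n\}$ nonempty, $\Delta_J=\mathrm{conv}\{e_i:i\in J\}\subset\mathbb R^n$. Loday's associahedron is the Minkowski sum $\mathfrak a_n=\sum_{1\le i\le j\le n}\Delta_{\{i,i+1,\dots,j\}}\subset\mathbb R^n$; it has dimension $n-1$. More generally for a linear order $\ell$ on a finite set $S$, $\mathfrak a_\ell\subset\mathbb RS$ is the Minkowski sum of the simplices $\Delta_J$ over all nonempty intervals $J$ of $\ell$. Every nonempty face $F$ of $\mathfrak a_n$ has the same normal fan as a product $\mathfrak a_{\ell_1}\times\cdots\times\mathfrak a_{\ell_k}$, where $\{1,\dots,n\}=S_1\sqcup\cdots\sqcup S_k$ is a partition into nonempty blocks and $\ell_i$ is a linear order on $S_i$; the factorization $F\cong\mathfrak a_{f_1}\times\cdots\times\mathfrak a_{f_k}$ in the statement is this one, with $f_i=|S_i|$ (so $f_1+\cdots+f_k=n$,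 point factors $\mathfrak a_1$ being counted, and $k=n-\dim F$). *)

(* Defs.v *)
From HB Require Import structures.
From mathcomp Require Import all_boot all_order all_algebra.
From mathcomp Require Import boolp classical_sets fsbigop reals convex.

Set Implicit Arguments.
Unset Strict Implicit.
Unset Printing Implicit Defensive.

Import Order.TTheory GRing.Theory Num.Theory.
Local Open Scope classical_set_scope.
Local Open Scope ring_scope.

Section Polytopes.
Variables (R : realType) (n : nat).
Notation V := 'rV[R]_n.
Implicit Types (P Q F : set V) (x y p q : V).

Definition dot x y : R := \sum_(i < n) x 0 i * y 0 i.

Definition convex_hull (A : set V) : set V :=
  smallest [set B : set V | convex_set (B : set (convex_lmodType V))] A.

Definition minkowski P Q : set V := [set p + q | p in P & q in Q].

(* The linear functionals on R^n are identified with vectors through [dot]. *)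
Definition face_in P y : set V :=
  [set p | P p /\ forall q, P q -> dot y q <= dot y p].

(* The improper face P itself is included: it is [face_in P 0]. *)
Definition faces P : set (set V) :=
  [set F | F !=set0 /\ exists y, F = face_in P y].

(* The functionals y such that F is contained in [face_in P y]. *)
Definition normal_cone P F : set V := [set y | F `<=` face_in P y].

Definition normal_fan P : set (set V) := [set normal_cone P F | F in faces P].

(* The largest k such that F contains k + 1 affinely independent points
   p, p + A_0, ..., p + A_(k-1), where A_i is the i-th row of A. *)
Definition affine_dim F : nat :=
  \max_(k < n.+1 |
      `[< exists p (A : 'M[R]_(k, n)),
            [/\ F p, forall i, F (p + row i A) & row_free A] >]) k.

Definition simplex (J : {set 'I_n}) : set V :=
  convex_hull [set delta_mx 0 i | i in [set i | i \in J]].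

Definition loday : set V :=
  \big[minkowski/[set 0]]_(ij : 'I_n * 'I_n | (ij.1 <= ij.2)%N)
    simplex [set k : 'I_n | (ij.1 <= k <= ij.2)%N].

(* A linear order on a subset S of 'I_n is encoded as the duplicate-free
   sequence l listing the elements of S in increasing order. *)

Definition segment (l : seq 'I_n) (a b : 'I_n) : {set 'I_n} :=
  [set x in l | (index a l <= index x l <= index b l)%N].

(* The nonempty intervals of l. *)
Definition intervals (l : seq 'I_n) : {set {set 'I_n}} :=
  [set segment l a b | a in l, b in l & (index a l <= index b l)%N].

(* R^S is embedded in R^n as the vectors vanishing outside S. *)
Definition associahedron (l : seq 'I_n) : set V :=
  \big[minkowski/[set 0]]_(J in intervals l) simplex J.

Definition coord_proj (l : seq 'I_n) x : V :=
  \row_i (if i \in l then x 0 i else 0).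

(* For a partition into blocks S_1, ..., S_k with linear orders l_1, ..., l_k,
   the product of the associahedra in R^(S_1) x ... x R^(S_k) = R^n. *)
Definition prod_associahedra (ls : seq (seq 'I_n)) : set V :=
  [set x | forall l, l \in ls -> associahedron l (coord_proj l x)].

Definition ordered_partition (ls : seq (seq 'I_n)) : bool :=
  ([::] \notin ls) && perm_eq (flatten ls) (enum 'I_n).

Definition factorizations F : set (seq (seq 'I_n)) :=
  [set ls | ordered_partition ls /\
            normal_fan F = normal_fan (prod_associahedra ls)].

(* c_(f_1) ... c_(f_k), where the f_i are the sizes of the blocks of a chosen
   factorization of F. The default value [::] is not reached when F is a face
   of [loday]. Different choices give the same value: the blocks of ls are
   determined by the lineality space of the normal fan of F, which is spanned
   by their indicator vectors. *)
Definition face_coef (K : fieldType) (c : nat -> K) F : K :=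
  \prod_(l <- xget [::] (factorizations F)) c (size l).

End Polytopes.

Section PowerSeries.
Variable K : fieldType.

(* Formal power series are given by their sequences of coefficients. *)

Definition fps_X : nat -> K := fun m => (m == 1%N)%:R.

(* The composite A(B(x)), for B with zero constant term: its coefficient of
   x^m depends only on the truncations of A and B modulo x^(m+1). *)
Definition fps_comp (A B : nat -> K) : nat -> K := fun m =>
  ((\poly_(i < m.+1) A i) \Po (\poly_(i < m.+1) B i))`_m.

Definition compositional_inverse (A B : nat -> K) : Prop :=
  [/\ A 0%N = 0, B 0%N = 0, fps_comp A B = fps_X & fps_comp B A = fps_X].

(* x + a_1 x^2 + a_2 x^3 + ...; the value a 0 is not used. *)
Definition tangent_series (a : nat -> K) : nat -> K := fun m =>
  match m with
  | 0%N => 0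
  | 1%N => 1
  | m'.+1 => a m'
  end.

End PowerSeries.

(* Main.v *)
Require Import Defs.
From HB Require Import structures.
From mathcomp Require Import all_boot all_order all_algebra.
From mathcomp Require Import boolp classical_sets fsbigop reals interval_inference convex.
From mathcomp Require Import zify.

Set Implicit Arguments.
Unset Strict Implicit.
Unset Printing Implicit Defensive.

Import Order.TTheory GRing.Theory Num.Theory.
Local Open Scope ring_scope.

(** The idea is to read off the functional equation C(D(x)) = x from the shape of
the faces.

The face of a Minkowski sum in direction y is the sum of the faces of the
summands, and the face of a simplex on J in direction y is the simplex on the
set of maximisers of y over J. Hence the face F_y of the associahedron in
direction y is the sum, over the intervals J, of the simplices on argmax_J y
[loday_faceE], and it remembers exactly which positions dominate which others,
where i dominates j if y_i is the largest entry between i and j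
[loday_face_eq]. Mutual domination is an equivalence relation. The sets
argmax_J y are precisely the intervals of its classes [maxima_intervals], and
the normal fan of a sum of simplices depends only on which simplices occur
[eq_normal_fan_msum]; so F_y has the normal fan of the product of the
associahedra of the classes, and the dimension of F_y is n minus the number of
classes [affine_dim_msum]. The intersection of all the cones of the normal fan
consists of the functionals that are constant on every block, so that a
factorization has the same block sizes as any other [face_coefE]. Altogether
F_y contributes the product of the - c_f over the class sizes f
[loday_face_term].

Let y attain its maximum r times. The top class has size r, and the remaining
data are independent patterns on the r + 1 gaps between the maxima. With
d_0 = 1 this says
  d_n = - sum_(r >= 1) c_r sum_(g_0 + ... + g_r = n - r) d_(g_0) ... d_(g_r),
that is, D - x = - sum_(r >= 1) c_r D^(r+1), which is C(D(x)) = x.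

For the enumeration it is simpler to cut y at its leftmost maximum only. This
encodes a domination relation by a binary tree in which each node carries one
bit: whether its value is attained again in its right subtree. Reduced trees
correspond bijectively to faces [pattern_exists, pattern_realizable,
models_dominates, models_transfer, pattern_unique]. If S_j is the generating
series of the weights of trees whose top class is enlarged by j further
elements, the binary decomposition gives a recursion [total_weightS] which,
once the missing case of an empty contribution to the top class is added,
becomes T_j = f_j S_0 + x S_0 T_(j+1) [completed_recursion]. Unrolling it gives
the sum of the f_r D^(r+1) [forest_equation], with D = x S_0. Here f_0 = 1 and
f_r = - c_r for r >= 1.

The other composite D(C(x)) = x follows by cancellation modulo each power of x
[comp_inverse_modXn]. *)

(** * Simplices in coordinates *)

Section Geometry.
Variables (R : realType) (n : nat).
Notation V := 'rV[R]_n.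
Implicit Types (x y w p q : V) (J : {set 'I_n}) (s : seq {set 'I_n}) (P Q : set V).

Definition vtx (i : 'I_n) : V := delta_mx 0 i.

Lemma vtxE i j : vtx i 0 j = (j == i)%:R.
Proof. by rewrite mxE eqxx. Qed.

Lemma dotDr y p q : dot y (p + q) = dot y p + dot y q.
Proof. by rewrite /dot -big_split; apply: eq_bigr => i _; rewrite mxE mulrDr. Qed.

Lemma dot_vtx y i : dot y (vtx i) = y 0 i.
Proof.
rewrite /dot (bigD1 i)//= vtxE eqxx mulr1 big1 ?addr0// => j /negPf ji.
by rewrite vtxE ji mulr0.
Qed.

(** Barycentric coordinates. Every point with nonnegative coordinates of sum 1 is
reached by splitting off one vertex at a time, by induction on the size of the
support. *)
Lemma simplexE J : simplex J = [set x : V | [/\ forall i, 0 <= x 0 i,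
  forall i, i \notin J -> x 0 i = 0 & \sum_i x 0 i = 1]]%classic.
Proof.
apply/seteqP; split.
  apply: smallest_sub => /=.
    move=> x y t; rewrite !inE /= => -[x0 xJ x1] [y0 yJ y1]; split=> [i|i iJ|].
    - rewrite !mxE addr_ge0// mulr_ge0//; by rewrite subr_ge0; exact: le1.
    - by rewrite !mxE xJ// yJ// !mulr0 addr0.
    - under eq_bigr do rewrite !mxE.
      by rewrite big_split/= -!mulr_sumr x1 y1 !mulr1 addrC; exact: subrK.
  move=> _ [i iJ <-]; split=> [j|j jJ|].
  - by rewrite -/(vtx i) vtxE ler0n.
  - by rewrite -/(vtx i) vtxE; case: eqP jJ iJ => // -> /negPf /= ->.
  - rewrite -/(vtx i) (bigD1 i)//= vtxE eqxx big1 ?addr0// => j /negPf ji.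
    by rewrite vtxE ji.
move=> x; move: {2}#|_| (leqnn #|[pred i | x 0 i != 0]|) => k.
elim: k x => [|k IH] x xk [x0 xJ x1] B [cB vB].
  suff : \sum_i x 0 i == 0 by rewrite x1 oner_eq0.
  rewrite big1// => i _; apply/eqP/negPn/negP => xi.
  by move: xk; rewrite leqn0 => /eqP/card0_eq/(_ i); rewrite inE xi.
have [i xi] : exists i, x 0 i != 0.
  apply/existsP; apply: contraT; rewrite negb_exists => /forallP h.
  move: x1; rewrite big1; first by move/eqP; rewrite eq_sym oner_eq0.
  by move=> i _; apply/eqP; move: (h i); rewrite negbK.
have iJ : i \in J by apply: contraT => /xJ /eqP; rewrite (negPf xi).
have Be : B (vtx i) by apply: vB; exists i.
move: (x1); rewrite (bigD1 i)//= => xi1.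
have r0 : 0 <= \sum_(j | j != i) x 0 j by apply: sumr_ge0.
have xi_le1 : x 0 i <= 1 by rewrite -xi1 lerDl.
have [xie|xine] := eqVneq (x 0 i) 1.
  have r1 : \sum_(j | j != i) x 0 j = 0 by apply: (addrI 1); rewrite -{1}xie xi1 addr0.
  suff -> : x = vtx i by [].
  apply/rowP => j; rewrite vtxE; case: (eqVneq j i) => [->//|ji].
  have := psumr_eq0P (P := fun j => j != i) (F := fun j => x 0 j) (fun j _ => x0 j) r1.
  by apply.
pose t : {i01 R} := Itv01 (x0 i) xi_le1.
(* x is the convex combination of vtx i and x' with coefficient x_i. *)
pose x' : V := (1 - x 0 i)^-1 *: (x - x 0 i *: vtx i).
have d0 : 1 - x 0 i != 0 by rewrite subr_eq0 eq_sym.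
have d1 : 0 < 1 - x 0 i by rewrite lt_neqAle eq_sym d0 subr_ge0.
have x'E j : x' 0 j = if j == i then 0 else (1 - x 0 i)^-1 * x 0 j.
  rewrite !mxE eqxx /=; case: eqVneq => [->|_]; first by rewrite mulr1 subrr mulr0.
  by rewrite mulr0 subr0.
have Bx' : B x'.
  apply: (IH x') => //.
    rewrite -ltnS; apply: leq_trans xk; apply: proper_card; apply/properP; split.
      apply/fintype.subsetP => j; rewrite !inE x'E; case: (eqVneq j i) => [_|_]; first by rewrite eqxx.
      by rewrite mulf_eq0 negb_or => /andP[].
    by exists i; rewrite inE ?xi// x'E eqxx eqxx.
  split=> [j|j jJ|].
  - by rewrite x'E; case: ifP => // _; rewrite mulr_ge0// invr_ge0 ltW.
  - by rewrite x'E (xJ j jJ) mulr0 if_same.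
  - rewrite (bigD1 i)//= x'E eqxx add0r (eq_bigr (fun j => (1 - x 0 i)^-1 * x 0 j)).
      by rewrite -mulr_sumr; apply: (mulfI d0); rewrite mulVKf// mulr1 -xi1 addrC addrK.
    by move=> j ji; rewrite x'E (negPf ji).
have := cB (vtx i) x' t; rewrite !inE => /(_ Be Bx').
congr B; rewrite /conv/= /x' scalerA divff// scale1r addrC; exact: subrK.
Qed.

End Geometry.

(** * Faces and normal fans of Minkowski sums of simplices *)

Section Minkowski.
Variables (R : realType) (n : nat).
Notation V := 'rV[R]_n.
Implicit Types (x y w p q : V) (J : {set 'I_n}) (s : seq {set 'I_n}) (P Q : set V).

(** A sequence, rather than a set, of index sets: taking the face in a direction
maps the indices, and different ones may then coincide. *)
Definition msum s : set V := \big[@minkowski R n/[set 0]%classic]_(J <- s) simplex J.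

Definition maxima y J : {set 'I_n} :=
  [set i in J | [forall (j | j \in J), y 0 j <= y 0 i]]%SET.

Definition nonempty_sets s := forall J, J \in s -> J != finset.set0.

Lemma maximaP y J i :
  reflect (i \in J /\ forall j, j \in J -> y 0 j <= y 0 i) (i \in maxima y J).
Proof.
rewrite inE; apply: (iffP andP) => -[iJ h]; split=> //.
  by move=> j jJ; move/forallP: h => /(_ j); rewrite jJ.
by apply/forallP => j; apply/implyP/h.
Qed.

Lemma maxima_sub y J : maxima y J \subset J.
Proof. by apply/fintype.subsetP => i /maximaP[]. Qed.

Lemma maxima_neq0 y J : J != finset.set0 -> maxima y J != finset.set0.
Proof.
case/finset.set0Pn => i0 i0J; apply/finset.set0Pn.
have [i iJ h] := @arg_maxP _ _ _ i0 (mem J) (fun i => y 0 i) i0J.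
by exists i; apply/maximaP.
Qed.

Lemma maxima0 J : maxima 0 J = J.
Proof.
by apply/setP => i; apply/maximaP/idP => [[]|iJ]//; split=> // j _; rewrite !mxE.
Qed.

Lemma vtx_simplex i J : simplex J (vtx R i) <-> i \in J.
Proof.
rewrite simplexE; split=> [[_ h _]|iJ].
  apply: contraT => /h; rewrite vtxE eqxx => /eqP; by rewrite oner_eq0.
split=> [j|j jJ|]; rewrite ?vtxE ?ler0n//.
  by case: eqP jJ iJ => // -> /negPf ->.
rewrite (bigD1 i)//= vtxE eqxx big1 ?addr0// => j /negPf ji.
by rewrite vtxE ji.
Qed.

Lemma simplex_mono J J' : J \subset J' -> ((simplex J : set V) `<=` simplex J')%classic.
Proof.
move=> JJ' x; rewrite !simplexE => -[x0 xJ x1]; split=> // i iJ'; apply: xJ.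
by apply: contra iJ' => /(fintype.subsetP JJ').
Qed.

(** On the simplex the functional is an average of the y_j with j in J, so a maximiser
puts no weight on an index where y is not maximal. *)
Lemma face_simplex J y : J != finset.set0 ->
  face_in (simplex J) y = simplex (maxima y J).
Proof.
move=> /(maxima_neq0 y)/finset.set0Pn[m mm]; have [mJ mmax] := maximaP _ _ _ mm.
have mle q : simplex J q -> dot y q <= y 0 m.
  rewrite simplexE => -[q0 qJ q1]; rewrite -[leRHS]mulr1 -q1 mulr_sumr.
  apply: ler_sum => i _; case: (boolP (i \in J)) => [iJ|/qJ ->]; last by rewrite !mulr0.
  by rewrite ler_wpM2r// mmax.
apply/seteqP; split=> x.
  case=> xS xmax; have := xS; rewrite !simplexE => -[x0 xJ x1]; split=> // i iM.
  case: (boolP (i \in J)) => [iJ|/xJ//].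
  have /xmax : simplex J (vtx R m) by apply/vtx_simplex.
  rewrite dot_vtx -[y 0 m]mulr1 -x1 mulr_sumr -subr_le0 -sumrB => le0.
  have ge0 j : true -> 0 <= y 0 m * x 0 j - y 0 j * x 0 j.
    move=> _; rewrite -mulrBl; case: (boolP (j \in J)) => [jJ|/xJ ->]; last by rewrite mulr0.
    by rewrite mulr_ge0// subr_ge0 mmax.
  have /psumr_eq0P/(_ i isT)/eqP : \sum_j (y 0 m * x 0 j - y 0 j * x 0 j) = 0.
    by apply/eqP; rewrite eq_le le0 sumr_ge0.
  rewrite -mulrBl mulf_eq0 => /(_ ge0)/orP[|/eqP//]; rewrite subr_eq0 => /eqP ym.
  case/negP: iM; apply/maximaP; split=> // j jJ; rewrite -ym; exact: mmax.
move=> xM; have xJ := simplex_mono (maxima_sub y J) xM; split=> // q /mle qm.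
suff -> : dot y x = y 0 m by [].
move: xM; rewrite simplexE => -[x0 xM x1]; rewrite -[RHS]mulr1 -x1 mulr_sumr.
apply: eq_bigr => i _; case: (boolP (i \in maxima y J)) => [|/xM ->]; last by rewrite !mulr0.
by move=> /maximaP[iJ im]; congr (_ * _); apply/eqP; rewrite eq_le im// mmax.
Qed.

Lemma face_summands P Q y p q : P p -> Q q ->
  face_in (minkowski P Q) y (p + q) -> face_in P y p /\ face_in Q y q.
Proof.
move=> Pp Qq [_ h]; split; split=> // r rP.
  have /h : minkowski P Q (r + q) by exists r => //; exists q.
  by rewrite !dotDr lerD2r.
have /h : minkowski P Q (p + r) by exists p => //; exists r.
by rewrite !dotDr lerD2l.
Qed.

Lemma face_minkowski P Q y :
  face_in (minkowski P Q) y = minkowski (face_in P y) (face_in Q y).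
Proof.
apply/seteqP; split=> x.
  move=> h; have [[p Pp [q Qq xpq]] _] := h; rewrite -xpq in h *.
  by have [? ?] := face_summands Pp Qq h; exists p => //; exists q.
case=> p [Pp hp] [q [Qq hq] <-]; split; first by exists p => //; exists q.
by move=> _ [p' Pp' [q' Qq' <-]]; rewrite !dotDr lerD// ?hp ?hq.
Qed.

Lemma msum_cons J s : msum (J :: s) = minkowski (simplex J) (msum s).
Proof. by rewrite /msum big_cons. Qed.

Lemma msum_nil : msum [::] = [set 0]%classic.
Proof. by rewrite /msum big_nil. Qed.

Lemma nonempty_cons J s :
  nonempty_sets (J :: s) -> J != finset.set0 /\ nonempty_sets s.
Proof.
by move=> h; split=> [|J' J's]; apply: h; rewrite inE ?eqxx// J's orbT.
Qed.

Lemma msum_neq0 s : nonempty_sets s -> (msum s !=set0)%classic.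
Proof.
elim: s => [|J s IH]; first by rewrite msum_nil; exists 0.
move=> /nonempty_cons[/finset.set0Pn[i iJ] /IH[q sq]].
by rewrite msum_cons; exists (vtx R i + q), (vtx R i); [apply/vtx_simplex|exists q].
Qed.

Lemma face_msum s y : nonempty_sets s ->
  face_in (msum s) y = msum [seq maxima y J | J <- s].
Proof.
elim: s => [_|J s IH /nonempty_cons[J0 s0]] /=.
  rewrite msum_nil; apply/seteqP; split=> x; first by case.
  by move=> /= ->; split=> // q ->.
by rewrite !msum_cons face_minkowski face_simplex// IH.
Qed.

Lemma nonempty_maxima s y : nonempty_sets s -> nonempty_sets [seq maxima y J | J <- s].
Proof. by move=> s0 _ /mapP[J Js ->]; apply/maxima_neq0/s0. Qed.

(** A face of the sum lies in another one exactly when this holds summand by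
summand: a sum that is maximal for w has all its summands maximal for w. *)
Lemma normal_cone_msum s y : nonempty_sets s ->
  normal_cone (msum s) (face_in (msum s) y) =
  [set w | forall J, J \in s -> maxima y J \subset maxima w J]%classic.
Proof.
move=> s0; rewrite /normal_cone face_msum//; apply/seteqP; split=> w /=.
  elim: s s0 => [//|J s IH /nonempty_cons[J0 s0]] h.
  rewrite /= !msum_cons in h.
  move=> J'; rewrite inE => /orP[/eqP -> {J'}|J's].
    have [q qs] := msum_neq0 (nonempty_maxima (y := y) s0).
    apply/fintype.subsetP => i iM.
    have /h : minkowski (simplex (maxima y J)) (msum [seq maxima y J | J <- s]) (vtx R i + q).
      by exists (vtx R i); [apply/vtx_simplex|exists q].
    have sq : msum s q by move: qs; rewrite -face_msum// => -[].
    have si : simplex J (vtx R i) by apply/vtx_simplex/(fintype.subsetP (maxima_sub y J)).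
    by move=> /(face_summands si sq)[]; rewrite face_simplex// => /vtx_simplex.
  apply: (IH s0) => // q qs.
  have /finset.set0Pn[i iM] := maxima_neq0 y J0.
  have /h : minkowski (simplex (maxima y J)) (msum [seq maxima y J | J <- s]) (vtx R i + q).
    by exists (vtx R i); [apply/vtx_simplex|exists q].
  have sq : msum s q by move: qs; rewrite -face_msum// => -[].
  have si : simplex J (vtx R i) by apply/vtx_simplex/(fintype.subsetP (maxima_sub y J)).
  by move=> /(face_summands si sq)[].
rewrite face_msum//; elim: s {s0} => [_ x //|J s IH] h /=.
rewrite !msum_cons => _ [p pJ [q qs <-]]; exists p.
  by apply: simplex_mono pJ; apply: h; rewrite mem_head.
by exists q => //; apply: IH qs => J' J's; apply: h; rewrite inE J's orbT.
Qed.

Lemma normal_fan_msum s : nonempty_sets s ->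
  normal_fan (msum s) =
  [set C | exists y,
    C = [set w | forall J, J \in s -> maxima y J \subset maxima w J]]%classic.
Proof.
move=> s0; apply/seteqP; split=> C.
  by case=> F [_ [y ->]] <-; exists y; rewrite normal_cone_msum.
case=> y ->; exists (face_in (msum s) y); last exact: normal_cone_msum.
split; last by exists y.
by rewrite face_msum//; apply/msum_neq0/nonempty_maxima.
Qed.

(** The cones only involve the collection of index sets, whence multiplicities do not
matter. This is what makes a face and a product of associahedra comparable,
since the former repeats its summands. *)
Lemma eq_normal_fan_msum s s' : nonempty_sets s -> s =i s' ->
  normal_fan (msum s) = normal_fan (msum s').
Proof.
move=> s0 ss'; have s'0 : nonempty_sets s' by move=> J; rewrite -ss'; apply: s0.
rewrite !normal_fan_msum//; apply/seteqP; split=> C [y ->]; exists y.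
  by apply/seteqP; split=> w h J; have := h J; rewrite ss'.
by apply/seteqP; split=> w h J; have := h J; rewrite ss'.
Qed.

(** The smallest cone of the fan is its lineality space; it is attained at the
improper face, the one in direction 0. *)
Lemma bigcap_normal_fan_msum s w : nonempty_sets s ->
  (forall C, normal_fan (msum s) C -> C w) <->
  (forall J, J \in s -> {in J &, forall i j, w 0 i = w 0 j}).
Proof.
move=> s0; rewrite normal_fan_msum//; split=> h.
  have := h _ (ex_intro _ 0 erefl) => /= {}h J /h; rewrite maxima0 => JM i j iJ jJ.
  have /maximaP[_ hi] := fintype.subsetP JM _ iJ.
  have /maximaP[_ hj] := fintype.subsetP JM _ jJ.
  by apply/eqP; rewrite eq_le hi// hj.
move=> _ [y ->] J Js; apply/fintype.subsetP => i /maximaP[iJ _].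
by apply/maximaP; split=> // j jJ; rewrite (h J Js j i jJ iJ).
Qed.

End Minkowski.

(** * Products of associahedra and the sizes of their blocks *)

Section Products.
Variables (R : realType) (n : nat).
Notation V := 'rV[R]_n.
Implicit Types (x y w p q : V) (J : {set 'I_n}) (s : seq {set 'I_n}).
Implicit Types (l : seq 'I_n) (ls : seq (seq 'I_n)).

Lemma segment_sub l a b : segment l a b \subset [set x in l]%SET.
Proof. by apply/fintype.subsetP => x; rewrite !inE => /andP[]. Qed.

Lemma intervals_sub l J : J \in intervals l -> J \subset [set x in l]%SET.
Proof. by case/imset2P => a b _ _ ->; exact: segment_sub. Qed.

Lemma intervals_neq0 l J : J \in intervals l -> J != finset.set0.
Proof.
case/imset2P => a b al; rewrite inE => /andP[bl ab] ->.
by apply/finset.set0Pn; exists a; rewrite !inE al leqnn ab.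
Qed.

(** The whole block is the interval from the first to the last entry. *)
Lemma block_interval l : uniq l -> l != [::] -> [set x in l]%SET \in intervals l.
Proof.
case: l => // a l ul _; apply/imset2P; exists a (last a l); rewrite ?mem_head//.
  by rewrite inE mem_last /= eqxx.
apply/setP => x; rewrite !finset.in_set index_head leq0n index_last// andTb.
by rewrite -ltnS -[X in (_ < X)%N]/(size (a :: l)) index_mem andbb.
Qed.

Definition block_intervals ls : seq {set 'I_n} :=
  flatten [seq enum (intervals l) | l <- ls].

Lemma mem_block_intervals ls J :
  reflect (exists2 l, l \in ls & J \in intervals l) (J \in block_intervals ls).
Proof.
apply: (iffP flatten_mapP) => -[l lls]; first by rewrite mem_enum; exists l.
by move=> JI; exists l => //; rewrite mem_enum.
Qed.

Lemma associahedronE l : associahedron l = msum (enum (intervals l)) :> set V.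
Proof. by rewrite /associahedron /msum -big_filter [index_enum _]unlock. Qed.

Lemma msum_cat s s' : msum (s ++ s') = minkowski (msum s) (msum s') :> set V.
Proof.
elim: s => [|J s IH] /=.
  rewrite msum_nil; apply/seteqP; split=> x.
    by move=> xs; exists 0 => //; exists x; rewrite ?add0r.
  by case=> _ -> [q qs <-]; rewrite add0r.
rewrite !msum_cons IH; apply/seteqP; split=> x.
  case=> p pJ [_ [q qs [r rs <-]] <-]; exists (p + q); last by exists r; rewrite ?addrA.
  by exists p => //; exists q.
case=> _ [p pJ [q qs <-]] [r rs <-]; exists p => //.
by exists (q + r); rewrite ?addrA//; exists q => //; exists r.
Qed.

Lemma msum_support s (A : {pred 'I_n}) x : (forall J, J \in s -> {subset J <= A}) ->
  msum s x -> forall i, i \notin A -> x 0 i = 0.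
Proof.
elim: s x => [|J s IH] x sA; first by rewrite msum_nil => -> i _; rewrite mxE.
rewrite msum_cons => -[p pJ [q qs <-]] i iA; rewrite mxE.
rewrite (IH q _ qs i iA) ?addr0; last by move=> J' J's; apply: sA; rewrite inE J's orbT.
move: pJ; rewrite simplexE => -[_ pJ _]; apply: pJ.
by apply: contra iA; apply: sA; rewrite mem_head.
Qed.

Lemma associahedron_support l x i : associahedron l x -> i \notin l -> x 0 i = 0.
Proof.
rewrite associahedronE => /msum_support; apply => J; rewrite mem_enum.
by move=> /intervals_sub/fintype.subsetP h j /h; rewrite inE.
Qed.

(** The summands of different blocks live in complementary coordinate subspaces, so
a sum decomposes uniquely and its parts are recovered by projection. *)
Lemma msum_block_intervals ls : uniq (flatten ls) ->
  msum (block_intervals ls) =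
  [set x : V | (forall i, i \notin flatten ls -> x 0 i = 0) /\
           forall l, l \in ls -> associahedron l (coord_proj l x)]%classic.
Proof.
rewrite /block_intervals; elim: ls => [_|l ls IH] /=.
  rewrite msum_nil; apply/seteqP; split=> x; first by move=> ->; split=> // i; rewrite mxE.
  by case=> h _; apply/rowP => i; rewrite h// mxE.
rewrite cat_uniq => /and3P[ul /hasPn disj uls].
have disj' i l' : l' \in ls -> i \in l' -> i \notin l.
  by move=> l'ls il'; apply: disj; apply/flattenP; exists l'.
rewrite msum_cat -associahedronE IH//; apply/seteqP; split=> x.
  case=> p pl [q [q0 qls] <-]; split=> [i|l'].
    by rewrite mem_cat negb_or mxE => /andP[/(associahedron_support pl) -> /q0 ->]; rewrite addr0.
  rewrite inE => /orP[/eqP ->|l'ls].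
    rewrite (_ : coord_proj _ _ = p)//; apply/rowP => i; rewrite !mxE.
    case: ifP => [il|/negbT/(associahedron_support pl) //].
    by rewrite q0 ?addr0//; apply/negP => /disj; rewrite /= il.
  rewrite (_ : coord_proj _ _ = coord_proj l' q); first exact: qls.
  apply/rowP => i; rewrite !mxE; case: ifP => // il'.
  by rewrite (associahedron_support pl) ?add0r// (disj' i l').
case=> x0 xls; exists (coord_proj l x); first by apply: xls; rewrite mem_head.
exists (x - coord_proj l x); last by rewrite addrC subrK.
split=> [i ils|l' l'ls].
  rewrite !mxE; case: ifP => [_|/negbT il]; first by rewrite subrr.
  by rewrite x0 ?subrr// mem_cat negb_or il.
rewrite (_ : coord_proj _ _ = coord_proj l' x); first by apply: xls; rewrite inE l'ls orbT.
apply/rowP => i; rewrite !mxE; case: ifP => // il'.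
by rewrite (negPf (disj' i l' l'ls il')) subr0.
Qed.

Lemma mem_ordered_partition ls i : ordered_partition ls -> i \in flatten ls.
Proof. by case/andP => _ /perm_mem ->; rewrite mem_enum. Qed.

Lemma uniq_ordered_partition ls : ordered_partition ls -> uniq (flatten ls).
Proof. by case/andP => _ /perm_uniq ->; apply: enum_uniq. Qed.

Lemma prod_associahedraE ls : ordered_partition ls ->
  prod_associahedra ls = msum (block_intervals ls) :> set V.
Proof.
move=> op; rewrite msum_block_intervals ?uniq_ordered_partition//.
apply/seteqP; split=> [x h|x []//]; split=> // i.
by rewrite mem_ordered_partition.
Qed.

Lemma nonempty_block_intervals ls : nonempty_sets (block_intervals ls).
Proof. by move=> J /mem_block_intervals[l _ /intervals_neq0]. Qed.

Lemma uniq_block ls l : uniq (flatten ls) -> l \in ls -> uniq l.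
Proof.
elim: ls => //= l' ls IH; rewrite cat_uniq inE => /and3P[ul' _ /IH h].
by case/orP => [/eqP -> //|/h].
Qed.

Lemma eq_block ls l l' i : uniq (flatten ls) -> l \in ls -> l' \in ls ->
  i \in l -> i \in l' -> l = l'.
Proof.
elim: ls => //= l0 ls IH; rewrite cat_uniq !inE => /and3P[_ /hasPn disj uls].
have D k : k \in ls -> i \in k -> i \notin l0.
  by move=> kls ik; apply: disj; apply/flattenP; exists k.
move=> /orP[/eqP ->|lls] /orP[/eqP ->|l'ls] il il' //; last exact: IH.
- by move: (D l' l'ls il'); rewrite il.
- by move: (D l lls il); rewrite il'.
Qed.

Definition blockwise_constant ls w :=
  forall l, l \in ls -> {in l &, forall i j, w 0 i = w 0 j}.

Lemma bigcap_normal_fan_prod ls w : ordered_partition ls ->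
  (forall C, normal_fan (prod_associahedra ls) C -> C w) <-> blockwise_constant ls w.
Proof.
move=> op; have [ne _] := andP op; have uf := uniq_ordered_partition op.
rewrite prod_associahedraE// bigcap_normal_fan_msum; last exact: nonempty_block_intervals.
split=> h.
  move=> l lls i j il jl; apply: (h [set x in l]%SET); rewrite ?inE//.
  apply/mem_block_intervals; exists l => //; apply: block_interval.
    exact: uniq_block lls.
  by apply: contraNneq ne => <-.
move=> J /mem_block_intervals[l lls /intervals_sub/fintype.subsetP Jl] i j /Jl + /Jl.
by rewrite !inE; apply: h.
Qed.

(** Tested on the indicator vector of a block of the second partition. *)
Lemma blockwise_constant_sub ls ls' : ordered_partition ls -> ordered_partition ls' ->
  (forall w, blockwise_constant ls' w -> blockwise_constant ls w) ->
  forall l l' i, l \in ls -> l' \in ls' -> i \in l -> i \in l' -> {subset l <= l'}.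
Proof.
move=> op op' h l l' i lls l'ls' il il' j jl.
pose w : V := \row_k (k \in l')%:R.
have : blockwise_constant ls w.
  apply: h => k kls a b ak bk; rewrite !mxE.
  have uf' := uniq_ordered_partition op'.
  have E c : c \in k -> (c \in l') = (k == l').
    by move=> ck; apply/idP/eqP => [cl'|<-//]; apply: (eq_block uf' kls l'ls' ck cl').
  by rewrite !E.
move=> /(_ l lls i j il jl); rewrite !mxE il'; case: (j \in l') => // /eqP.
by rewrite oner_eq0.
Qed.

(** Comparing indicator vectors, both partitions have the same blocks as sets; only
their orders may differ. *)
Lemma prod_blocks_determined (K : fieldType) (c : nat -> K) ls ls' :
  ordered_partition ls -> ordered_partition ls' ->
  (forall w, blockwise_constant ls w <-> blockwise_constant ls' w) ->
  \prod_(l <- ls) c (size l) = \prod_(l <- ls') c (size l).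
Proof.
have toset (ks : seq (seq 'I_n)) : ordered_partition ks ->
    \prod_(l <- ks) c (size l) = \prod_(B <- [seq [set x in l]%SET | l <- ks]) c #|B|.
  move=> op; rewrite big_map big_seq [RHS]big_seq; apply: eq_bigr => l lks.
  have ul := uniq_block (uniq_ordered_partition op) lks.
  congr c; rewrite -(card_uniqP ul); apply: eq_card => x; by rewrite inE.
have uset (ks : seq (seq 'I_n)) : ordered_partition ks ->
    uniq [seq [set x in l]%SET | l <- ks].
  move=> op; have uf := uniq_ordered_partition op; have [ne _] := andP op.
  rewrite map_inj_in_uniq.
    elim: ks ne uf {op} => //= k ks IH; rewrite inE negb_or => /andP[k0 ne].
    rewrite cat_uniq => /and3P[_ /hasPn disj uks]; rewrite IH// andbT.
    apply/negP => kks; case: k k0 disj kks => // a k _ disj kks.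
    have /disj : a \in flatten ks by apply/flattenP; exists (a :: k); rewrite ?mem_head.
    by rewrite /= mem_head.
  move=> k k' kks k'ks /setP E.
  case: k kks E => [|a k] kks E; first by rewrite kks in ne.
  have := E a; rewrite !inE eqxx /= => /esym ak'.
  by apply: (eq_block uf kks k'ks (mem_head _ _) ak').
move=> op op' W; rewrite !toset//; apply: perm_big; apply: uniq_perm; rewrite ?uset//.
have S ks ks' : ordered_partition ks -> ordered_partition ks' ->
    (forall w, blockwise_constant ks w <-> blockwise_constant ks' w) ->
    {subset [seq [set x in l]%SET | l <- ks] <= [seq [set x in l]%SET | l <- ks']}.
  move=> ok ok' Wk B /mapP[l lks ->{B}]; have [ne _] := andP ok.
  case: l lks => [|a l] lks; first by rewrite lks in ne.
  have /flattenP[l' l'ks al'] := mem_ordered_partition a ok'.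
  apply/mapP; exists l' => //; apply/setP => x; rewrite !inE; apply/idP/idP.
    have := @blockwise_constant_sub ks ks' ok ok' (fun w => (Wk w).2) _ _ a lks l'ks.
    by move=> /(_ (mem_head _ _) al' x); rewrite inE.
  have := @blockwise_constant_sub ks' ks ok' ok (fun w => (Wk w).1) _ _ a l'ks lks.
  by move=> /(_ al' (mem_head _ _) x); rewrite inE.
move=> B; apply/idP/idP; first exact: S.
by apply: S => // w; split=> /W.
Qed.

(** The chosen factorization and the given one share the lineality space of the
normal fan, hence their block sizes. *)
Lemma face_coefE (K : fieldType) (c : nat -> K) (F : set V) ls :
  factorizations F ls -> face_coef c F = \prod_(l <- ls) c (size l).
Proof.
move=> Fls; have [op' E'] := xgetI [::] Fls; have [op E] := Fls.
apply: prod_blocks_determined => // w.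
by rewrite -!bigcap_normal_fan_prod// -E -E'.
Qed.

End Products.

(** * Dimension of a sum of simplices adapted to a partition *)

Section Dimension.
Variables (R : realType) (n : nat) (ls : seq (seq 'I_n)).
Hypothesis part_ls : ordered_partition ls.
Notation V := 'rV[R]_n.
Implicit Types (x y w p q : V) (J : {set 'I_n}) (s : seq {set 'I_n}).

Definition block_of i := nth [::] ls (find (fun l : seq 'I_n => i \in l) ls).
Definition rep i := head i (block_of i).

Lemma has_block i : has (fun l : seq 'I_n => i \in l) ls.
Proof. by have /flattenP[l lls il] := mem_ordered_partition i part_ls; apply/hasP; exists l. Qed.

Lemma block_ofP i : i \in block_of i /\ block_of i \in ls.
Proof.
split; first exact: (nth_find [::] (has_block i)).
by apply: mem_nth; rewrite -has_find; exact: has_block.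
Qed.

Lemma block_ofE l i : l \in ls -> i \in l -> block_of i = l.
Proof.
have [? ?] := block_ofP i => lls il.
exact: (eq_block (i := i) (uniq_ordered_partition part_ls)).
Qed.

Lemma rep_head a l i : a :: l \in ls -> i \in a :: l -> rep i = a.
Proof. by move=> lls il; rewrite /rep (block_ofE lls il). Qed.

Lemma mem_rep i : rep i \in block_of i.
Proof. by rewrite /rep; case: (block_of i) (block_ofP i).1 => //= a l _; rewrite mem_head. Qed.

Lemma eq_rep l i j : l \in ls -> i \in l -> j \in l -> rep i = rep j.
Proof. by case: l => // a l lls il jl; rewrite !(rep_head lls). Qed.

Lemma rep_rep i : rep (rep i) = rep i.
Proof. by have [? lls] := block_ofP i; apply: (eq_rep lls) => //; apply: mem_rep. Qed.

Definition nonreps : {set 'I_n} := [set i | rep i != i]%SET.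

(** Each block contains exactly one representative. *)
Lemma card_nonreps : (n - #|nonreps| = size ls)%N.
Proof.
have <- : #|~: nonreps| = (n - #|nonreps|)%N by rewrite cardsCs finset.setCK card_ord.
have -> : #|~: nonreps| = count (fun i => rep i == i) (flatten ls).
  rewrite cardE -size_filter; apply/perm_size/uniq_perm; rewrite ?enum_uniq//.
    exact/filter_uniq/uniq_ordered_partition.
  move=> i; rewrite mem_enum mem_filter !inE negbK.
  by rewrite mem_ordered_partition// andbT.
have [ne _] := andP part_ls; have uf := uniq_ordered_partition part_ls.
rewrite count_flatten.
have count1 l : l \in ls -> count (fun i => rep i == i) l = 1%N.
  case: l => [|a l] lls; first by rewrite lls in ne.
  rewrite -(@eq_in_count _ (pred1 a)); last by move=> i il /=; rewrite (rep_head lls il) eq_sym.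
  by rewrite count_uniq_mem ?mem_head// (uniq_block uf lls).
have /eq_in_map -> : {in ls, count (fun i => rep i == i) =1 fun=> 1%N} by exact: count1.
by elim: (ls) => //= l ks ->.
Qed.

(** A basis, indexed by the entries i that do not represent their block, of the space
of vectors whose coordinates have sum 0 on each block. *)
Definition block_basis : 'M[R]_(#|nonreps|, n) :=
  \matrix_(a < #|nonreps|) (vtx R (enum_val a) - vtx R (rep (enum_val a))).

Lemma block_basisE a j : block_basis a j =
  (j == enum_val a)%:R - (j == rep (enum_val a))%:R.
Proof. by rewrite /block_basis !mxE !eqxx. Qed.

Lemma row_free_block_basis : row_free block_basis.
Proof.
apply/row_freeP; exists (\matrix_(j, a) (j == enum_val a)%:R).
apply/matrixP => a b; rewrite !mxE (bigD1 (enum_val b))//= big1 ?addr0.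
  rewrite block_basisE [X in _ * X]mxE eqxx mulr1 (inj_eq enum_val_inj) eq_sym.
  rewrite (_ : (enum_val b == rep _) = false) ?subr0//.
  by apply/eqP => E; have := enum_valP b; rewrite !inE E rep_rep eqxx.
by move=> j /negPf jb; rewrite [X in _ * X]mxE jb mulr0.
Qed.

(** A vector with sum 0 on every block is recovered from its coordinates at the
non-representatives, the remaining one of each block being minus their sum. *)
Lemma block_basis_span (k : nat) (A : 'M[R]_(k, n)) :
  (forall w, blockwise_constant ls w -> forall i, dot w (row i A) = 0) ->
  A = (\matrix_(i, a) A i (enum_val a)) *m block_basis.
Proof.
move=> h; apply/matrixP => i j; rewrite mxE.
under eq_bigr do rewrite mxE block_basisE mulrBr.
rewrite sumrB.
have sumN (F : 'I_n -> R) : \sum_(a < #|nonreps|) F (enum_val a) = \sum_(b in nonreps) F b.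
  exact: esym (big_enum_val (A := [in nonreps]) F).
rewrite (sumN (fun b => A i b * (j == b)%:R)) (sumN (fun b => A i b * (j == rep b)%:R)).
have wls : blockwise_constant ls (\row_b (rep b == rep j)%:R : V).
  by move=> l lls a b al bl; rewrite !mxE (eq_rep lls al bl).
have {wls} := h _ wls i.
rewrite /dot; under eq_bigr do rewrite !mxE.
case: (boolP (j \in nonreps)) => jN.
  move=> _; rewrite (bigD1 j)//= eqxx mulr1 big1 ?addr0.
    rewrite big1 ?subr0// => b _; case: eqP => [E|]; last by rewrite mulr0.
    by move: jN; rewrite inE E rep_rep eqxx.
  by move=> b /andP[_ /negPf bj]; rewrite eq_sym bj mulr0.
have rj : rep j = j by apply/eqP; move: jN; rewrite inE negbK.
rewrite [X in X - _]big1 ?sub0r; last first.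
  by move=> b bN; case: eqP => [E|]; rewrite ?mulr0//; rewrite E bN in jN.
rewrite (bigID (mem nonreps)) /= addrC (bigD1 j)//= big1 ?addr0.
  rewrite eqxx mul1r rj => /eqP; rewrite addr_eq0 => /eqP ->; congr (- _).
  by apply: eq_bigr => b _; rewrite mulrC eq_sym.
move=> b /andP[]; rewrite inE negbK => /eqP -> bj.
by rewrite rj (negPf bj) mul0r.
Qed.

Lemma dot_msum_const s w p q : nonempty_sets s ->
  (forall J, J \in s -> {in J &, forall i j, w 0 i = w 0 j}) ->
  msum s p -> msum s q -> dot w p = dot w q.
Proof.
move=> s0 h.
have <- : face_in (msum s) w = msum s.
  rewrite face_msum// (_ : [seq maxima w J | J <- s] = s)//.
  rewrite -[RHS]map_id; apply/eq_in_map => J Js.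
  apply/setP => i; apply/maximaP/idP => [[]//|iJ]; split=> // j jJ.
  by rewrite (h J Js j i).
by move=> [ps pm] [qs qm]; apply/eqP; rewrite eq_le pm// qm.
Qed.

Lemma msum_sum s (r : {set 'I_n} -> V) :
  (forall J, J \in s -> simplex J (r J)) -> msum s (\sum_(J <- s) r J).
Proof.
elim: s => [|J s IH] hr; first by rewrite msum_nil big_nil.
rewrite msum_cons big_cons; exists (r J); first by apply: hr; rewrite mem_head.
by exists (\sum_(J <- s) r J) => //; apply: IH => K Ks; apply: hr; rewrite inE Ks orbT.
Qed.

Lemma msum_exchange s (r : {set 'I_n} -> V) J0 b :
  (forall J, J \in s -> simplex J (r J)) -> J0 \in s -> b \in J0 ->
  msum s (\sum_(J <- s) r J + (vtx R b - r J0)).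
Proof.
elim: s => // J s IH hr J0s bJ0.
have rJ : simplex J (r J) by apply: hr; rewrite mem_head.
have hr' K : K \in s -> simplex K (r K) by move=> Ks; apply: hr; rewrite inE Ks orbT.
rewrite msum_cons big_cons; move: J0s; rewrite inE => /orP[/eqP J0J|J0s].
  exists (vtx R b); first by apply/vtx_simplex; rewrite -J0J.
  exists (\sum_(J <- s) r J); first exact: msum_sum.
  by rewrite J0J [RHS]addrC addrA subrK.
exists (r J) => //; exists (\sum_(J <- s) r J + (vtx R b - r J0)); first exact: IH.
by rewrite addrA.
Qed.

(** Functionals that are constant on the blocks are constant on the sum, so it is
parallel to the span of the block basis. Conversely, moving the vertex chosen in
the summand of a full block from the representative to another entry translates
a fixed point by any given basis vector. *)
Lemma affine_dim_msum s : nonempty_sets s ->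
  (forall J, J \in s -> exists2 l, l \in ls & {subset J <= l}) ->
  (forall l, l \in ls -> [set x in l]%SET \in s) ->
  affine_dim (msum s : set V) = #|nonreps|.
Proof.
move=> s0 sls lss; apply/eqP; rewrite eqn_leq; apply/andP; split.
  apply/bigmax_leqP => k /asboolP[p [A [ps pA Afree]]].
  have E : A = (\matrix_(i, a) A i (enum_val a)) *m block_basis.
    apply: block_basis_span => w wls i.
    apply: (addrI (dot w p)); rewrite addr0 -dotDr.
    apply: (@dot_msum_const s) => // J /sls[l lls Jl] a b /Jl al /Jl bl.
    exact: wls lls a b al bl.
  by rewrite -(eqP Afree) E mulmx_max_rank.
have Nn : (#|nonreps| < n.+1)%N by rewrite ltnS -[leqRHS]card_ord max_card.
apply: (bigop.bigmax_sup (Ordinal Nn)) => //; apply/asboolP => /=.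
(* A vertex of each summand: the representative if J contains one, as full blocks do. *)
pose r J : V := if [pick i in J | rep i == i] is Some i then vtx R i
  else if [pick i in J] is Some i then vtx R i else 0.
have rP J : J \in s -> simplex J (r J).
  move=> /s0/finset.set0Pn[i iJ]; rewrite /r; case: pickP => [j /andP[jJ _]|_].
    exact/vtx_simplex.
  by case: pickP => [j jJ|/(_ i)]; [exact/vtx_simplex|rewrite iJ].
have rB b : r [set x in block_of b]%SET = vtx R (rep b).
  have [bB Bls] := block_ofP b.
  rewrite /r; case: pickP => [i|/(_ (rep b))]; last by rewrite inE mem_rep rep_rep eqxx.
  by rewrite inE => /andP[iB /eqP <-]; rewrite (eq_rep Bls iB bB).
exists (\sum_(J <- s) r J), block_basis; split; last exact: row_free_block_basis.
  exact: msum_sum.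
move=> a; have [bB Bls] := block_ofP (enum_val a).
rewrite rowK -rB; apply: (msum_exchange rP (lss _ Bls)).
by rewrite inE.
Qed.

End Dimension.

(** * Faces of the associahedron and domination of positions *)

Section LodayFaces.
Variables (R : realType) (n : nat).
Notation V := 'rV[R]_n.
Implicit Types (y z : nat -> R) (J : {set 'I_n}) (i j k a b : 'I_n).

(** A face only depends on y through this relation, for which directions are taken as
functions on all of nat so that they can be restricted to any interval of
positions. *)
Definition dominates y (i j : nat) :=
  forall k : nat, (minn i j <= k <= maxn i j)%N -> y k <= y i.

Definition vec y : V := \row_i y i.

Definition interval a b : {set 'I_n} := [set k : 'I_n | (a <= k <= b)%N]%SET.

Definition all_intervals : seq {set 'I_n} :=
  [seq interval ab.1 ab.2 | ab <- enum [pred ab : 'I_n * 'I_n | (ab.1 <= ab.2)%N]].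

Lemma lodayE : @loday R n = msum all_intervals.
Proof.
by rewrite /msum /all_intervals big_map /loday -[LHS]big_filter [index_enum _]unlock.
Qed.

Lemma mem_all_intervals J :
  reflect (exists a b, (a <= b)%N /\ J = interval a b) (J \in all_intervals).
Proof.
apply: (iffP mapP) => [[[a b]]|[a [b [ab ->]]]].
  by rewrite mem_enum inE /= => ab ->; exists a, b.
by exists (a, b) => //; rewrite mem_enum.
Qed.

Lemma nonempty_all_intervals : nonempty_sets all_intervals.
Proof.
move=> J /mem_all_intervals[a [b [ab ->]]]; apply/finset.set0Pn; exists a.
by rewrite inE leqnn.
Qed.

Lemma maxima_interval y a b i : (a <= i <= b)%N ->
  (i \in maxima (vec y) (interval a b)) <-> (dominates y i a /\ dominates y i b).
Proof.
move=> /andP[ai ib]; have ab := leq_trans ai ib; split.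
  case/maximaP => _ h; have {}h (k : nat) : (a <= k <= b)%N -> y k <= y i.
    move=> kab; have kn : (k < n)%N by apply: leq_ltn_trans (ltn_ord b); case/andP: kab.
    by have := h (Ordinal kn); rewrite !mxE inE /=; apply.
  split=> k /andP[k1 k2]; apply: h.
    by rewrite (minn_idPr ai) in k1; rewrite (maxn_idPl ai) in k2; rewrite k1 (leq_trans k2).
  by rewrite (minn_idPl ib) in k1; rewrite (maxn_idPr ib) in k2; rewrite k2 (leq_trans _ k1).
case=> ia ib'; apply/maximaP; rewrite inE ai ib; split=> // k; rewrite inE !mxE => /andP[ak kb].
case: (leqP k i) => ki; first by apply: ia; rewrite (minn_idPr ai) (maxn_idPl ai) ak ki.
by apply: ib'; rewrite (minn_idPl ib) (maxn_idPr ib) kb ltnW.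
Qed.

Definition loday_face y : set V := face_in (@loday R n) (vec y).

Lemma loday_faceE y :
  loday_face y = msum [seq maxima (vec y) J | J <- all_intervals].
Proof. by rewrite /loday_face lodayE face_msum//; exact: nonempty_all_intervals. Qed.

Lemma dominates_maxima y i j :
  dominates y i j <->
  i \in maxima (vec y) (if (i <= j)%N then interval i j else interval j i).
Proof.
have refl : dominates y i i by move=> k; rewrite minnn maxnn -eqn_leq => /eqP <-.
case: leqP => [ij|/ltnW ij]; rewrite maxima_interval ?leqnn ?ij//.
  by split=> [|[]].
by split=> [|[]].
Qed.

(** The maximisers over the interval [a, b] are the positions of [a, b] that dominate
both a and b, and domination of j by i is maximality over the interval between
them. *)
Lemma loday_face_eq y z :
  loday_face y = loday_face z <->
  forall i j, dominates y i j <-> dominates z i j.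
Proof.
have ne := nonempty_all_intervals.
split=> [E|h].
  have S (u v : nat -> R) : loday_face u = loday_face v ->
      forall J, J \in all_intervals -> maxima (vec u) J \subset maxima (vec v) J.
    move=> uv; have : normal_cone (@loday R n) (loday_face u) (vec v).
      by rewrite uv => x.
    by rewrite /loday_face lodayE normal_cone_msum.
  move=> i j; rewrite !dominates_maxima; set J := if _ then _ else _.
  have JI : J \in all_intervals.
    by rewrite /J; apply/mem_all_intervals; case: leqP => [?|/ltnW ?]; [exists i, j|exists j, i].
  by split; apply/fintype.subsetP/S.
rewrite !loday_faceE; congr msum; apply/eq_in_map => J /mem_all_intervals[a [b [ab ->]]].
apply/setP => i; case: (boolP (a <= i <= b)%N) => iab.
  by apply/idP/idP; rewrite !maxima_interval// !h.
have F (u : nat -> R) : i \in maxima (vec u) (interval a b) = false.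
  by apply/negP => /maximaP[]; rewrite inE (negPf iab).
by rewrite !F.
Qed.

Lemma facesE F : faces (@loday R n) F <-> exists y, F = loday_face y.
Proof.
split=> [[_ [w ->]]|[y ->]].
  exists (fun k : nat => if (insub k : option (ordinal n)) is Some i then w 0 i else 0).
  by congr face_in; apply/rowP => i; rewrite mxE valK.
split; last by exists (vec y).
by rewrite loday_faceE; apply/msum_neq0/nonempty_maxima/nonempty_all_intervals.
Qed.

Definition class_blocks y (ls : seq (seq 'I_n)) :=
  [/\ ordered_partition ls,
      forall l, l \in ls -> sorted (fun i j => (i < j)%N) l &
      forall i j, (exists l, [/\ l \in ls, i \in l & j \in l]) <->
                  dominates y i j /\ dominates y j i].

Lemma sorted_index (l : seq 'I_n) a b : sorted (fun i j => (i < j)%N) l ->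
  a \in l -> b \in l -> (index a l <= index b l)%N = (a <= b)%N.
Proof.
move=> sl al bl.
have tr : transitive (fun i j : 'I_n => (i < j)%N) by move=> ? ? ?; apply: ltn_trans.
have L c d : c \in l -> d \in l -> (index c l < index d l)%N -> (c < d)%N.
  move=> cl dl cd; have := @sorted_ltn_nth _ _ tr a l sl (index c l) (index d l).
  by rewrite !inE !index_mem !nth_index//; apply.
case: (ltngtP (index a l) (index b l)) => [/(L _ _ al bl)/ltnW ->//|/(L _ _ bl al)|E].
  by rewrite ltnNge => /negPf.
by rewrite -(nth_index a al) E nth_index// leqnn.
Qed.

Lemma segmentE (l : seq 'I_n) a b : sorted (fun i j => (i < j)%N) l -> a \in l -> b \in l ->
  segment l a b = [set x in l | (a <= x <= b)%N]%SET.
Proof.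
move=> sl al bl; apply/setP => x; rewrite !inE; case: (boolP (x \in l)) => //= xl.
by rewrite !sorted_index.
Qed.

(** Over [a, b] the maximisers are the part of one class that lies in [a, b]; and if a
and b are in the same class, the part of it between them is maximal over [a, b]. *)
Lemma maxima_intervals y ls : class_blocks y ls ->
  [seq maxima (vec y) J | J <- all_intervals] =i block_intervals ls.
Proof.
case=> op srt same M.
have leD i j k : dominates y i j -> (i <= k <= j)%N || (j <= k <= i)%N -> y k <= y i.
  move=> D h; apply: D; case/orP: h => /andP[h1 h2].
    by rewrite (minn_idPl (leq_trans h1 h2)) (maxn_idPr (leq_trans h1 h2)) h1.
  by rewrite (minn_idPr (leq_trans h1 h2)) (maxn_idPl (leq_trans h1 h2)) h1.
have dom_max i a b : i \in maxima (vec y) (interval a b) ->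
    [/\ (a <= i <= b)%N & forall k, (a <= k <= b)%N -> y k <= y i].
  case/maximaP; rewrite inE => iab h; split=> // k kab.
  by have := h k; rewrite inE !mxE; apply.
apply/idP/idP.
  case/mapP => J JI ->; have := nonempty_all_intervals JI.
  case/mem_all_intervals: JI => a [b [ab ->]] /(maxima_neq0 (vec y))/finset.set0Pn[i0 i0M].
  have [i0ab i0max] := dom_max _ _ _ i0M.
  have /flattenP[l lls i0l] := mem_ordered_partition i0 op.
  (* l is the class of the maxima over [a, b]. *)
  have ME : maxima (vec y) (interval a b) = [set x in l | (a <= x <= b)%N]%SET.
    apply/setP => x; rewrite [RHS]inE; apply/idP/andP.
      move=> xM; have [xab xmax] := dom_max _ _ _ xM; split=> //.
      have B u v : (a <= u <= b)%N -> (a <= v <= b)%N ->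
          forall k : nat, (minn u v <= k <= maxn u v)%N -> (a <= k <= b)%N.
        move=> /andP[au ub] /andP[av vb] k /andP[k1 k2]; apply/andP; split.
          by apply: leq_trans k1; rewrite leq_min au.
        by apply: leq_trans k2 _; rewrite geq_max ub.
      have D u v : u \in maxima (vec y) (interval a b) -> v \in maxima (vec y) (interval a b) ->
          dominates y u v.
        move=> /dom_max[uab umax] /dom_max[vab _] k /(B _ _ uab vab) kab.
        have kn : (k < n)%N by apply: leq_ltn_trans (ltn_ord b); case/andP: kab.
        exact: (umax (Ordinal kn)).
      have /same[l' [l'ls xl' i0l']] : dominates y x i0 /\ dominates y i0 x by split; apply: D.
      by rewrite (eq_block (uniq_ordered_partition op) lls l'ls i0l i0l').
    case=> xl xab; apply/maximaP; rewrite inE xab; split=> // k; rewrite inE !mxE => kab.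
    have [Dx Di] : dominates y x i0 /\ dominates y i0 x by apply/same; exists l.
    apply: le_trans (i0max k kab) _; apply: leD Dx _.
    by case: (leqP i0 x) => h; rewrite ?h leqnn ?andbT ?orbT//= ltnW.
  rewrite ME; apply/mem_block_intervals; exists l => //.
  pose S := [set x in l | (a <= x <= b)%N]%SET.
  have i0S : i0 \in S by rewrite inE i0l.
  case: (@arg_minnP _ i0 (mem S) (fun x => nat_of_ord x) i0S) => a' /= a'S a'min.
  case: (@arg_maxnP _ i0 (mem S) (fun x => nat_of_ord x) i0S) => b' /= b'S b'max.
  have [[a'l a'ab] [b'l b'ab]] : (a' \in l /\ a <= a' <= b)%N /\ (b' \in l /\ a <= b' <= b)%N.
    by move: a'S b'S; rewrite !inE => /andP[? ?] /andP[? ?].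
  have sl := srt _ lls.
  apply/imset2P; exists a' b' => //.
    by rewrite inE b'l /= (sorted_index sl)// a'min.
  rewrite (segmentE sl)//; apply/setP => x; rewrite !inE; case: (boolP (x \in l)) => //= xl.
  apply/idP/idP => [xab|/andP[x1 x2]].
    have xS : x \in S by rewrite inE xl.
    by rewrite a'min//= b'max.
  by case/andP: a'ab => a1 _; case/andP: b'ab => _ b2; rewrite (leq_trans a1)// (leq_trans x2).
case/mem_block_intervals => l lls /imset2P[a b al]; rewrite inE => /andP[bl].
have sl := srt _ lls.
rewrite (sorted_index sl)// => ab ->; rewrite segmentE//.
have [Dab Dba] : dominates y a b /\ dominates y b a by apply/same; exists l.
suff <- : maxima (vec y) (interval a b) = [set x in l | (a <= x <= b)%N]%SET.
  by apply: map_f; apply/mem_all_intervals; exists a, b.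
apply/setP => x; rewrite [RHS]inE; apply/idP/andP.
  move=> xM; have [xab xmax] := dom_max _ _ _ xM; split=> //.
  have /same[l' [l'ls xl' al']] : dominates y x a /\ dominates y a x.
    have [h _] := (maxima_interval y xab).1 xM; split=> // k.
    case/andP: xab => ax xb.
    rewrite (minn_idPl ax) (maxn_idPr ax) => /andP[ak kx].
    apply: Dab; rewrite (minn_idPl ab) (maxn_idPr ab) ak; exact: leq_trans xb.
  by rewrite (eq_block (uniq_ordered_partition op) lls l'ls al al').
case=> xl xab; apply/maximaP; rewrite inE xab; split=> // k; rewrite inE !mxE => kab.
have [Dx _] : dominates y x a /\ dominates y a x by apply/same; exists l.
apply: le_trans (leD _ _ _ Dab _) (leD _ _ _ Dx _); first by rewrite kab.
by case/andP: xab => -> _; rewrite leqnn orbT.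
Qed.

(** Both the sign and the coefficient are products over the classes, the codimension
n - dim F being their number. *)
Lemma loday_face_term (K : fieldType) (c : nat -> K) y ls : class_blocks y ls ->
  (-1) ^+ (n - affine_dim (loday_face y)) * face_coef c (loday_face y) =
  \prod_(l <- ls) - c (size l).
Proof.
move=> yls; have [op _ _] := yls; have E := maxima_intervals yls.
have ne0 : nonempty_sets [seq maxima (vec y) J | J <- all_intervals].
  exact/nonempty_maxima/nonempty_all_intervals.
rewrite (@face_coefE R n K c _ ls); last first.
  by split=> //; rewrite prod_associahedraE// loday_faceE; apply: eq_normal_fan_msum.
rewrite loday_faceE (affine_dim_msum R op)//.
- rewrite card_nonreps//; elim: (ls) => [|l ks IH]; first by rewrite !big_nil mulr1.
  by rewrite !big_cons -IH exprS -!mulrA mulN1r mulNr; congr (- _); rewrite mulrCA.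
- move=> J; rewrite E => /mem_block_intervals[l lls /intervals_sub/fintype.subsetP Jl].
  by exists l => // x /Jl; rewrite inE.
- move=> l lls; rewrite E; apply/mem_block_intervals; exists l => //.
  apply: block_interval; first exact: uniq_block (uniq_ordered_partition op) lls.
  by have [ne _] := andP op; apply: contraNneq ne => <-.
Qed.

End LodayFaces.

(** * Binary trees encoding domination relations *)

(** The domination relation of a finite sequence of reals. A node is the leftmost
maximum, its subtrees describe the entries before and after it, and the bit
tells whether the maximum occurs again after it. *)
Inductive pattern := Leaf | Node of pattern & bool & pattern.
HB.instance Definition _ := gen_eqMixin pattern.

Fixpoint psize t := if t is Node a _ b then (psize a + (psize b).+1)%N else 0%N.

(** An empty right subtree leaves the bit undetermined; it is then fixed to be true. *)
Fixpoint reduced t :=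
  if t is Node a fl b then [&& reduced a, reduced b & fl || (0 < psize b)%N] else true.

(** The positions of the maxima, for a pattern placed at the positions from o on. *)
Fixpoint top_block t o : seq nat :=
  if t is Node a fl b then
    let k := (o + psize a)%N in k :: if fl then top_block b k.+1 else [::]
  else [::].

(** The remaining classes. Empty blocks, which come from empty subtrees, are kept: this
makes the recursion uniform, and they are given weight 1. *)
Fixpoint low_blocks t o : seq (seq nat) :=
  if t is Node a fl b then
    let k := (o + psize a)%N in
    top_block a o :: low_blocks a o ++
    (if fl then low_blocks b k.+1 else top_block b k.+1 :: low_blocks b k.+1)
  else [::].

Definition blocks t o := top_block t o :: low_blocks t o.

Lemma perm_blocks t o : perm_eq (flatten (blocks t o)) (iota o (psize t)).
Proof.
apply/permP => P; rewrite /blocks /= count_cat.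
elim: t o => //= a IHa fl b IHb o.
rewrite flatten_cat !count_cat iotaD count_cat /= -(IHa o) -(IHb (o + psize a).+1).
by case: fl => /=; rewrite ?count_cat; lia.
Qed.

Lemma mem_blocks t o l i : l \in blocks t o -> i \in l -> (o <= i < o + psize t)%N.
Proof.
move=> lb il; rewrite -mem_iota -(perm_mem (perm_blocks t o)).
by apply/flattenP; exists l.
Qed.

Lemma sorted_blocks t o l : l \in blocks t o -> sorted ltn l.
Proof.
elim: t o l => [|a IHa fl b IHb] o l; first by rewrite inE => /eqP ->.
rewrite inE => /orP[/eqP ->|].
  rewrite /=; case: fl => //=.
  have := IHb (o + psize a).+1 _ (mem_head _ _).
  have := @mem_blocks b (o + psize a).+1 _ _ (mem_head _ _).
  by case: top_block => //= x s /(_ x (mem_head _ _)) ? ->; rewrite andbT; lia.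
rewrite /= -cat_cons mem_cat => /orP[/IHa//|lb].
by apply: (IHb (o + psize a).+1); move: lb; case: fl => //; rewrite /blocks inE => ->; rewrite orbT.
Qed.

Section Patterns.
Variable R : realType.
Implicit Types (y z : nat -> R) (t : pattern) (o i j k : nat).

(** The entries of y from position o on realise the pattern t. *)
Fixpoint models y t o : Prop :=
  if t is Node a fl b then
    let k := (o + psize a)%N in
    [/\ forall i, (o <= i < k)%N -> y i < y k,
        forall i, (k < i < k.+1 + psize b)%N -> y i <= y k,
        (0 < psize b)%N -> fl <-> exists i, (k < i < k.+1 + psize b)%N /\ y i = y k,
        models y a o & models y b k.+1]
  else True.

Lemma models_node y a fl b o (k := (o + psize a)%N) : models y (Node a fl b) o =
  [/\ forall i, (o <= i < k)%N -> y i < y k,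
      forall i, (k < i < k.+1 + psize b)%N -> y i <= y k,
      (0 < psize b)%N -> fl <-> exists i, (k < i < k.+1 + psize b)%N /\ y i = y k,
      models y a o & models y b k.+1].
Proof. by []. Qed.

Lemma first_max y m o : exists k, [/\ (o <= k < o + m.+1)%N,
  forall i, (o <= i < k)%N -> y i < y k &
  forall i, (k < i < o + m.+1)%N -> y i <= y k].
Proof.
elim: m => [|m [k [kr kl kg]]].
  exists o; split=> [|i|i]; [lia| |]; move=> h; exfalso; lia.
case: (leP (y (o + m.+1)%N) (y k)) => ey.
  exists k; split=> [||i ir]; [lia|by []|].
  by case: (eqVneq i (o + m.+1)%N) => [->//|ie]; apply: kg; lia.
exists (o + m.+1)%N; split=> [|i ir|i]; [lia| |move=> ?; exfalso; lia].
apply: le_lt_trans ey; case: (ltngtP i k) => ik; last by rewrite ik.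
  by apply/ltW/kl; lia.
by apply: kg; lia.
Qed.

Lemma pattern_exists y m o : exists t, [/\ reduced t, psize t = m & models y t o].
Proof.
elim/ltn_ind: m o => -[|m] IH o; first by exists Leaf.
have [k [kr kl kg]] := first_max y m o.
have [a [ca sa ma]] := IH (k - o)%N ltac:(lia) o.
have [b [cb sb mb]] := IH (o + m.+1 - k.+1)%N ltac:(lia) k.+1.
have kE : (o + psize a)%N = k by lia.
pose fl := `[< (0 < psize b)%N -> exists i, (k < i < k.+1 + psize b)%N /\ y i = y k >].
exists (Node a fl b); split=> /=; [|lia|].
  rewrite ca cb /=; case: posnP => [b0|]; last by rewrite orbT.
  by rewrite orbF; apply/asboolP; rewrite b0.
rewrite kE; split=> //.
  by move=> i ir; apply: kg; lia.
by move=> b0; split=> [/asboolP/(_ b0)//|h]; apply/asboolP.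
Qed.

Lemma models_ext y z t o : (forall i, (o <= i < o + psize t)%N -> y i = z i) ->
  models y t o -> models z t o.
Proof.
elim: t o => //= a IHa fl b IHb o h [kl kg fE ma mb].
have kE : y (o + psize a)%N = z (o + psize a)%N by apply: h; lia.
split=> [i ir|i ir|b0||].
- by rewrite -kE -h ?kl//; lia.
- by rewrite -kE -h ?kg//; lia.
- rewrite (fE b0); split=> -[i [ir e]]; exists i; split=> //.
    by rewrite -kE -h ?e//; lia.
  by rewrite kE h ?e//; lia.
- by apply: (IHa _ _ ma) => i ir; apply: h; lia.
- by apply: (IHb _ _ mb) => i ir; apply: h; lia.
Qed.

(** The bound h is needed for the induction: the right subtree is realised with
maximum h or h - 1 according to the bit of the root. *)
Lemma pattern_realizable t o (h : R) : exists y, [/\ models y t o,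
  forall i, (o <= i < o + psize t)%N -> y i <= h &
  (0 < psize t)%N -> exists i, (o <= i < o + psize t)%N /\ y i = h].
Proof.
elim: t o h => [|a IHa fl b IHb] o h /=.
  by exists (fun=> 0); split=> // i; lia.
set k := (o + psize a)%N.
have h1 : h - 1 < h by rewrite gtrDl oppr_lt0 ltr01.
have [ya [ma ah _]] := IHa o (h - 1).
have [yb [mb bh bmax]] := IHb k.+1 (if fl then h else h - 1).
pose y i := if (i < k)%N then ya i else if i == k then h else yb i.
have yk : y k = h by rewrite /y ltnn eqxx.
have yl i : (i < k)%N -> y i = ya i by rewrite /y => ->.
have yg i : (k < i)%N -> y i = yb i.
  by rewrite /y => ki; rewrite ltnNge ltnW//= gtn_eqF.
exists y; split.
- rewrite -/k yk; split=> [i ir|i ir|b0||].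
  + by rewrite yl; [apply: le_lt_trans (ah _ _) h1; lia|lia].
  + rewrite yg; last lia.
    have := bh i; case: (fl) => bi; last (apply: le_trans (ltW h1)); apply: bi; lia.
  + split=> [flt|[i [ir]]].
      have [i [ir e]] := bmax b0; exists i; rewrite yg; last lia.
      by split; [lia|rewrite e flt].
    rewrite yg; last lia.
    have := bh i; case: (fl) => // bi e; have := le_lt_trans (bi ltac:(lia)) h1; by rewrite e ltxx.
  + by apply: (models_ext _ ma) => i ir; rewrite yl//; lia.
  + by apply: (models_ext _ mb) => i ir; rewrite yg//; lia.
- move=> i ir; case: (ltngtP i k) => ik; last by rewrite ik yk.
    by rewrite yl//; apply: le_trans (ah _ _) (ltW h1); lia.
  rewrite yg//; have := bh i; case: (fl) => bi; last (apply: le_trans (ltW h1)); apply: bi; lia.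
- by move=> _; exists k; split=> //; lia.
Qed.

Lemma top_blockP y t o i : models y t o -> (o <= i < o + psize t)%N ->
  (i \in top_block t o) <-> (forall j, (o <= j < o + psize t)%N -> y j <= y i).
Proof.
elim: t o => [|a _ fl b IHb] o; first by move=> _ /=; lia.
move=> /= [kl kg fE _ mb]; set k := (o + psize a)%N in kl kg fE mb *.
move=> ir.
have kmax j : (o <= j < o + (psize a + (psize b).+1))%N -> y j <= y k.
  move=> jr; case: (ltngtP j k) => jk; last by rewrite jk.
    by apply/ltW/kl; lia.
  by apply: kg; lia.
have topE : (forall j, (o <= j < o + (psize a + (psize b).+1))%N -> y j <= y i) <-> y i = y k.
  split=> [h|-> //]; apply/eqP; rewrite eq_le kmax// h//; lia.
rewrite topE inE; case: (ltngtP i k) => ik /=.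
- split=> [|e]; last by have := kl i; rewrite e ltxx => /(_ ltac:(lia)).
  case: (fl) => // /(mem_blocks (mem_head _ _)); lia.
- have ib : (k.+1 <= i < k.+1 + psize b)%N by lia.
  have b0 : (0 < psize b)%N by lia.
  case: (fl) fE => [/(_ b0)[/(_ isT)[j [jr e]] _]|/(_ b0)[_ h]].
    rewrite (IHb _ mb ib); split=> [bmax|ik' j' j'r]; last by rewrite ik' kg.
    by apply/eqP; rewrite eq_le kg//= -e bmax.
  by split=> // ik'; suff : false by []; apply: h; exists i.
- by rewrite ik.
Qed.

Lemma dominates_le y i j k : dominates y i j -> (i <= k <= j)%N || (j <= k <= i)%N ->
  y k <= y i.
Proof. by move=> D h; apply: D; lia. Qed.

(** Domination across the root k is the only case not covered by the subtrees: i > k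
dominates a position up to k iff y_i = y_k, that is, iff i is in the top block. *)
Lemma models_dominates y z t o : models y t o -> models z t o ->
  forall i j, (o <= i < o + psize t)%N -> (o <= j < o + psize t)%N ->
  dominates y i j -> dominates z i j.
Proof.
elim: t o => [|a IHa fl b IHb] o; first by move=> _ _ i j /=; lia.
move=> my mz; move: (my) (mz); rewrite !models_node; set k := (o + psize a)%N.
have kE : k = (o + psize a)%N by [].
move=> [ykl ykg yE ya yb] [zkl zkg zE za zb].
have zmax j : (o <= j < o + psize (Node a fl b))%N -> z j <= z k.
  move=> /= jr; case: (ltngtP j k) => jk; last by rewrite jk.
    by apply/ltW/zkl; lia.
  by apply: zkg; lia.
move=> i j ir jr; have := ir; have := jr => /= jr' ir' D.
case: (ltnP i k) => ik.
  case: (ltnP j k) => jk; first exact: (IHa o ya za i j ltac:(lia) ltac:(lia) D).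
  have := ykl i; rewrite ltNge (dominates_le D (k := k)) => [|]; last lia.
  by move=> /(_ ltac:(lia)).
case: (ltnP k j) => jk.
  case: (ltnP k i) => ki; first exact: (IHb k.+1 yb zb i j ltac:(lia) ltac:(lia) D).
  have -> : i = k by lia.
  move=> j' j'r; apply: zmax => /=. lia.
have top_i : i \in top_block (Node a fl b) o.
  apply/(top_blockP my ir) => j' /= j'r; apply: le_trans (dominates_le D (k := k) _).
    case: (ltngtP j' k) => j'k; last by rewrite j'k.
      by apply/ltW/ykl; lia.
    by apply: ykg; lia.
  lia.
by move/(top_blockP mz ir) : top_i => zi j' j'r; apply: zi => /=; lia.
Qed.

(** All the clauses in the definition of a pattern can be phrased by domination. *)
Lemma models_transfer y z t o :
  (forall i j, (o <= i < o + psize t)%N -> (o <= j < o + psize t)%N ->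
     dominates y i j <-> dominates z i j) ->
  models y t o -> models z t o.
Proof.
elim: t o => [//|a IHa fl b IHb] o D; rewrite !models_node; set k := (o + psize a)%N.
have kE : k = (o + psize a)%N by [].
move=> [kl kg fE ma mb].
have kr : (o <= k < o + psize (Node a fl b))%N by rewrite /=; lia.
have ymax j : (o <= j < o + psize (Node a fl b))%N -> y j <= y k.
  move=> /= jr; case: (ltngtP j k) => jk; last by rewrite jk.
    by apply/ltW/kl; lia.
  by apply: kg; lia.
have zmax j : (o <= j < o + psize (Node a fl b))%N -> z j <= z k.
  move=> jr; have : dominates z k j.
    by apply/D => // j' j'r; apply: ymax; lia.
  by apply; lia.
have zE i : (o <= i < o + psize (Node a fl b))%N -> (y i = y k) <-> (z i = z k).
  move=> ir; split=> e.
    have : dominates z i k by apply/D => // j j'r; rewrite e; apply: ymax; lia.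
    by move=> /dominates_le h; apply/eqP; rewrite eq_le zmax//= h//; lia.
  have : dominates y i k by apply/D => // j j'r; rewrite e; apply: zmax; lia.
  by move=> /dominates_le h; apply/eqP; rewrite eq_le ymax//= h//; lia.
rewrite /= in kr ymax zmax zE D *; split.
- move=> i ir; rewrite lt_neqAle zmax ?andbT; last lia.
  apply/eqP => /zE e; have := kl i ir; rewrite e ?ltxx//; lia.
- by move=> i ir; apply: zmax; lia.
- move=> b0; rewrite (fE b0); split=> -[i [ir /zE e]]; exists i; split=> //; apply: e; lia.
- by apply: (IHa _ _ ma) => i j ir jr; apply: D; lia.
- by apply: (IHb _ _ mb) => i j ir jr; apply: D; lia.
Qed.

(** The root is the leftmost maximum of y, so its position is determined. *)
Lemma pattern_unique y t t' o : reduced t -> reduced t' ->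
  psize t = psize t' -> models y t o -> models y t' o -> t = t'.
Proof.
elim: t t' o => [|a IHa fl b IHb] [|a' fl' b'] o //=; try lia.
move=> /and3P[ca cb cf] /and3P[ca' cb' cf'] ss [kl kg fE ma mb] [kl' kg' fE' ma' mb'].
have sa : psize a = psize a'.
  case: (ltngtP (psize a) (psize a')) => // h.
    have := kl' (o + psize a)%N; rewrite ltNge kg => [|]; last lia.
    by move=> /(_ ltac:(lia)).
  have := kl (o + psize a')%N; rewrite ltNge kg' => [|]; last lia.
  by move=> /(_ ltac:(lia)).
have sb : psize b = psize b' by lia.
rewrite -sa in mb' fE'; rewrite -(IHa a' o)// -(IHb b' (o + psize a).+1)//.
congr (Node _ _ _); case: (posnP (psize b)) => b0.
  by move: cf cf'; rewrite -sb b0 !orbF => -> ->.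
by apply/idP/idP => h; [apply/fE'; rewrite -?sb//; apply/fE|apply/fE; rewrite // sb; apply/fE'; rewrite -?sb].
Qed.

(** Two positions that dominate each other carry the same value. If it is not the
maximum, then the root cannot lie between them. *)
Lemma blocks_dominates y t o : models y t o ->
  forall i j, (o <= i < o + psize t)%N -> (o <= j < o + psize t)%N ->
  (exists l, [/\ l \in blocks t o, i \in l & j \in l]) <->
  dominates y i j /\ dominates y j i.
Proof.
elim: t o => [|a IHa fl b IHb] o; first by move=> _ i j /=; lia.
move=> my; move: (my); rewrite models_node; set k := (o + psize a)%N.
have kE : k = (o + psize a)%N by [].
move=> [kl kg fE ma mb].
have bl : blocks (Node a fl b) o = (k :: if fl then top_block b k.+1 else [::]) ::
    blocks a o ++ if fl then low_blocks b k.+1 else blocks b k.+1 by [].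
move=> i j ir jr; have := ir; have := jr => /= jr' ir'; split.
  case=> l []; rewrite bl inE => /orP[/eqP ->|].
    rewrite -[_ :: _]/(top_block (Node a fl b) o).
    move=> /(top_blockP my ir) it /(top_blockP my jr) jt.
    by split=> k' k'r; [apply: it|apply: jt]; rewrite /=; lia.
  rewrite mem_cat => /orP[la il jl|lb il jl].
    by apply/(IHa o ma); [exact: mem_blocks la il|exact: mem_blocks la jl|exists l].
  have lb' : l \in blocks b k.+1.
    by move: lb; case: (fl) => // lb; rewrite inE lb orbT.
  by apply/(IHb k.+1 mb); [exact: mem_blocks lb' il|exact: mem_blocks lb' jl|exists l].
case=> Dij Dji.
have eij : y i = y j.
  by apply/eqP; rewrite eq_le (dominates_le Dij) ?(dominates_le Dji)//; lia.
case: (boolP (i \in top_block (Node a fl b) o)) => it.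
  exists (top_block (Node a fl b) o); split=> //; first exact: mem_head.
  by apply/(top_blockP my jr) => j' j'r; rewrite -eij; exact: (top_blockP my ir).1.
have ik : y i < y k.
  rewrite ltNge; apply: contra it => ki; apply/(top_blockP my ir) => j' /= j'r.
  apply: le_trans ki; case: (ltngtP j' k) => j'k; last by rewrite j'k.
    by apply/ltW/kl; lia.
  by apply: kg; lia.
have side : (i < k)%N /\ (j < k)%N \/ (k < i)%N /\ (k < j)%N.
  case: (ltngtP i k) => ci; last by move: ik; rewrite ci ltxx.
    case: (ltnP j k) => cj; [by left|exfalso].
    by move: ik; rewrite ltNge (dominates_le Dij)//; lia.
  case: (ltnP k j) => cj; [by right|exfalso].
  by move: ik; rewrite ltNge (dominates_le Dij)//; lia.
case: side => -[ci cj].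
  have [l [lb il jl]] := (IHa o ma i j ltac:(lia) ltac:(lia)).2 (conj Dij Dji).
  by exists l; split=> //; rewrite bl inE mem_cat lb orbT.
have [l [lb il jl]] := (IHb k.+1 mb i j ltac:(lia) ltac:(lia)).2 (conj Dij Dji).
have [flE|flE] : fl \/ ~~ fl by case: (fl); [left|right].
  move: lb; rewrite inE => /orP[/eqP lE|lb].
    case/negP: it; rewrite /= -/k flE inE -lE il orbT//.
  by exists l; split=> //; rewrite bl inE mem_cat flE lb !orbT.
by exists l; split=> //; rewrite bl inE mem_cat (negPf flE) lb !orbT.
Qed.

End Patterns.

(** * Formal power series modulo powers of X *)

Section Series.
Variable K : fieldType.
Implicit Types (p q A B : {poly K}) (N : nat).

Lemma dvdXnP p q N :
  reflect (forall i, (i < N)%N -> p`_i = q`_i) ('X^N %| p - q).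
Proof.
apply: (iffP idP) => [/dvdpP[g E] i iN|h].
  by apply/eqP; rewrite -subr_eq0 -coefB E coefMXn iN.
rewrite -(poly_take_drop N (p - q)) (_ : take_poly N (p - q) = 0).
  by rewrite add0r dvdp_mull.
by apply/polyP => i; rewrite coef_take_poly coef0 coefB; case: ifP => // /h ->; rewrite subrr.
Qed.

Lemma comp_poly_sum N (a : nat -> K) q :
  (\poly_(i < N) a i) \Po q = \sum_(i < N) a i *: q ^+ i.
Proof.
rewrite poly_def raddf_sum /=; apply: eq_bigr => i _.
by rewrite comp_polyZ comp_Xn_poly.
Qed.

(** With U = B(A(x)), associativity gives A(U) = A(x) modulo X^N. Since
A(U) - A(x) = (U - x) G with G(0) = A'(0) = 1, the factor G can be cancelled. *)
Lemma comp_inverse_modXn A B N : A`_0 = 0 -> B`_0 = 0 -> A`_1 = 1 ->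
  'X^N %| A \Po B - 'X -> 'X^N %| B \Po A - 'X.
Proof.
move=> A0 B0 A1 /dvdpP[g gE]; set U := B \Po A.
have U0 : U.[0] = 0 by rewrite horner_comp [A.[0]]horner_coef0 A0 horner_coef0.
pose G := \sum_(i < size A) A`_i *: \sum_(j < i) U ^+ (i.-1 - j) * 'X ^+ j.
(* Coefficientwise, U^i - X^i is divisible by U - X. *)
have AE : A \Po U - A = (U - 'X) * G.
  rewrite /G mulr_sumr -{2}[A]coefK poly_def comp_polyE -sumrB.
  by apply: eq_bigr => i _; rewrite -scalerBr subrXX scalerAr.
have : 'X^N %| A \Po U - A.
  rewrite /U comp_polyA -[A \Po B](subrK 'X) gE comp_polyD comp_polyX addrK.
  rewrite comp_polyM comp_Xn_poly dvdp_mull// dvdp_exp2r//.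
  by rewrite -['X]subr0 dvdp_XsubCl /root horner_coef0 A0.
rewrite AE Gauss_dvdpl// coprimep_expl// coprimep_sym coprimepX /root.
have sA : (1 < size A)%N.
  by rewrite ltnNge; apply/negP => /leq_sizeP/(_ 1%N (leqnn _))/eqP; rewrite A1 oner_eq0.
rewrite /G horner_sum (bigD1 (Ordinal sA))//= A1 big_ord1 scale1r subnn !expr0 mulr1.
rewrite hornerC big1 ?addr0 ?oner_eq0// => i i1.
rewrite hornerZ; case: i i1 => -[|[|i]] //= si i1; first by rewrite A0 mul0r.
rewrite horner_sum big1 ?mulr0// => j _; rewrite hornerM !horner_exp hornerX U0.
case: (posnP j) => [->|j0]; last by rewrite [0 ^+ j]expr0n gtn_eqF// mulr0.
by rewrite subn0 expr0n mul0r.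
Qed.

Variables (f : nat -> K) (S : nat -> nat -> K).
Hypothesis f0 : f 0%N = 1.
Hypothesis S_0 : forall j, S j 0%N = f j.
Hypothesis S_rec : forall j m, S j m.+1 =
  \sum_(k < m.+1) S 0%N k * (S j.+1 (m - k)%N + (k < m)%N%:R * (f j.+1 * S 0%N (m - k)%N)).

(** The sums S_j leave out the case in which the top class receives no element beside
the j given ones, except at size 0. Adding it gives all sequences of values
bounded by a given maximum. *)
Let T j m := S j m + (0 < m)%N%:R * (f j * S 0%N m).

Let q N := \poly_(i < N) S 0%N i.
Let p N j := \poly_(i < N) T j i.

Lemma completed_recursion N j : 'X^N %| p N j - (f j *: q N + 'X * q N * p N j.+1).
Proof.
apply/dvdXnP => i iN; rewrite -mulrA coefD coefZ coefXM !coef_poly iN.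
case: i iN => [|m] mN /=.
  by rewrite /T /= mul0r !addr0 !S_0 f0 mulr1.
rewrite {1}/T mul1r S_rec [LHS]addrC; congr (_ + _).
rewrite coefM; apply: eq_bigr => k _; rewrite !coef_poly.
have km : (k <= m)%N by rewrite -ltnS.
rewrite (leq_ltn_trans km (ltnW mN)) (leq_ltn_trans (leq_subr _ _) (ltnW mN)).
by rewrite /T subn_gt0.
Qed.

Lemma completed_expansion N M j :
  'X^N %| p N j - (\sum_(r < M) f (j + r)%N *: (('X * q N) ^+ r * q N) +
                   ('X * q N) ^+ M * p N (j + M)%N).
Proof.
elim: M j => [|M IH] j.
  by rewrite big_ord0 add0r !expr0 !mul1r addn0 subrr dvdp0.
have := dvdp_add (completed_recursion N j) (dvdp_mull ('X * q N) (IH j.+1)).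
congr (_ %| _); rewrite mulrBr opprD !addrA subrK -addrA -opprD; congr (_ - _).
rewrite mulrDr mulr_sumr.
rewrite big_ord_recl addn0 expr0 mul1r -addrA; congr (_ + (_ + _)).
  by apply: eq_bigr => r _; rewrite -scalerAr mulrA -exprS addSnnS.
by rewrite mulrA -exprS addSnnS.
Qed.

(** At j = 0 the completed series is 2 S_0 - 1, the added term being S_0 itself outside
size 0. *)
Lemma forest_equation N :
  'X^N %| \sum_(r < N) f r *: ('X * q N) ^+ r.+1 - ('X * q N *+ 2 - 'X).
Proof.
case: N => [|N]; first by rewrite dvd1p.
have := dvdp_mull 'X (completed_expansion N.+1 N.+1 0).
have -> : p N.+1 0 = q N.+1 *+ 2 - 1.
  apply/polyP => i; rewrite coefB coefMn coef1 !coef_poly; case: ifP => iN.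
    case: i iN => [|i] _; rewrite /T /= ?mul0r ?addr0 ?S_0 ?f0 ?subr0 ?mul1r ?mulr2n//.
    by rewrite addrK.
  by case: i iN => // i _; rewrite mul0rn subr0.
rewrite -dvdpNr -mulrN opprB => h.
have h2 : 'X^(N.+1) %| 'X * (('X * q N.+1) ^+ N.+1 * p N.+1 (0 + N.+1)%N).
  by rewrite exprMn; apply: dvdp_mull; rewrite -mulrA; apply: dvdp_mulr; exact: dvdpp.
have := dvdp_sub h h2; congr (_ %| _); rewrite -mulrBr addrAC addrK mulrBr mulr_sumr.
congr (_ - _); last by rewrite mulrBr mulr1 mulrnAr.
by apply: eq_bigr => r _; rewrite -scalerAr exprSr mulrCA.
Qed.

End Series.

Section Inversion.
Variables (K : fieldType) (c d f : nat -> K) (S : nat -> nat -> K).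
Hypothesis fE : forall k, f k = if k == 0%N then 1 else - c k.
Hypothesis S_0 : forall j, S j 0%N = f j.
Hypothesis S_rec : forall j m, S j m.+1 =
  \sum_(k < m.+1) S 0%N k * (S j.+1 (m - k)%N + (k < m)%N%:R * (f j.+1 * S 0%N (m - k)%N)).
Hypothesis dE : forall m, (0 < m)%N -> d m = S 0%N m.

Lemma tangent_comp N :
  'X^N %| (\poly_(i < N) tangent_series c i) \Po (\poly_(i < N) tangent_series d i) - 'X.
Proof.
have f0 : f 0%N = 1 by rewrite fE.
set D := \poly_(i < N) tangent_series d i.
case: N => [|N] in D *; first by rewrite dvd1p.
set q := \poly_(i < N.+1) S 0%N i.
have DE : 'X^(N.+1) %| D - 'X * q.
  apply/dvdXnP => i iN; rewrite coefXM !coef_poly iN.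
  case: i iN => [|[|i]] iN //=; first by rewrite S_0 f0.
  by rewrite (ltnW iN) dE.
have De r : 'X^(N.+1) %| D ^+ r - ('X * q) ^+ r by rewrite subrXX dvdp_mulr.
have := forest_equation f0 S_0 S_rec N.+1; rewrite -/q => h.
rewrite comp_poly_sum big_ord_recl /= scale0r add0r.
have E : 'X^(N.+1) %| \sum_(i < N) tangent_series c i.+1 *: D ^+ i.+1
    - \sum_(i < N) tangent_series c i.+1 *: ('X * q) ^+ i.+1.
  rewrite -sumrB; apply: (big_ind (fun x => 'X^(N.+1) %| x)) => [|x y|i _].
  - exact: dvdp0.
  - exact: dvdp_add.
  by rewrite -scalerBr -mul_polyC dvdp_mull.
rewrite -(subrKA (\sum_(i < N) tangent_series c i.+1 *: ('X * q) ^+ i.+1)).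
apply: dvdp_add E _.
case: N q h {D DE De} => [|N] q h; first by rewrite big_ord0 sub0r dvdpNr expr1.
(* The term of index N.+1 vanishes modulo X^(N.+2). *)
have last_term : 'X^(N.+2) %| f N.+1 *: ('X * q) ^+ N.+2.
  by rewrite -mul_polyC exprMn dvdp_mull// dvdp_mulr.
have := dvdp_sub last_term h; congr (_ %| _).
have -> : \sum_(r < N.+2) f r *: ('X * q) ^+ r.+1 = f N.+1 *: ('X * q) ^+ N.+2 +
    ('X * q *+ 2 - \sum_(i < N.+1) tangent_series c i.+1 *: ('X * q) ^+ i.+1).
  rewrite big_ord_recr /= addrC; congr (_ + _).
  rewrite !big_ord_recl /= f0 !scale1r expr1 mulr2n addrKA -sumrN; congr (_ + _).
  by apply: eq_bigr => i _; rewrite fE /= scaleNr.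
by rewrite -addrA opprD addNKr !opprB addrC addrA subrK.
Qed.

Lemma series_inversion :
  compositional_inverse (tangent_series c) (tangent_series d).
Proof.
have compE m : 'X^(m.+1) %| (\poly_(i < m.+1) tangent_series d i) \Po
    (\poly_(i < m.+1) tangent_series c i) - 'X.
  case: m => [|m].
    by rewrite !poly_def !big_ord1 /= !scale0r comp_poly0 sub0r dvdpNr expr1.
  by apply: comp_inverse_modXn; rewrite ?coef_poly//; apply: tangent_comp.
split=> //; apply/funext => m; rewrite /fps_X /fps_comp.
  by rewrite (dvdXnP _ _ _ (tangent_comp m.+1))// coefX.
by rewrite (dvdXnP _ _ _ (compE m))// coefX.
Qed.

End Inversion.

(** * Weighted enumeration of the trees *)

Section Weights.
Variables (K : fieldType) (f : nat -> K).
Hypothesis f0 : f 0%N = 1.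

(** The product of f over the class sizes, where the top class is counted with j
additional elements: these are the equal maxima already met on the way down. *)
Fixpoint weight j t : K :=
  if t is Node a fl b then
    weight 0 a * (if fl then weight j.+1 b else f j.+1 * weight 0 b)
  else f j.

Lemma weight_blocks t o j :
  weight j t = f (j + size (top_block t o)) * \prod_(l <- low_blocks t o) f (size l).
Proof.
elim: t o j => [|a IHa fl b IHb] o j /=; first by rewrite big_nil mulr1 addn0.
rewrite big_cons big_cat /= (IHa o) add0n; case: fl => /=.
  by rewrite (IHb (o + psize a).+1) addnS addSn mulrCA -!mulrA; congr (_ * _); rewrite mulrCA.
rewrite (IHb (o + psize a).+1) big_cons add0n addn1.
by rewrite mulrCA -!mulrA.
Qed.

Lemma weight0_blocks t : weight 0 t = \prod_(l <- blocks t 0) f (size l).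
Proof. by rewrite (weight_blocks t 0) big_cons. Qed.

Definition joins (ta tb : seq pattern) (strict : bool) :=
  [seq Node a true b | a <- ta, b <- tb] ++
  (if strict then [seq Node a false b | a <- ta, b <- tb] else [::]).

(** The reduced patterns with m nodes, for m <= h; the bound h makes the recursion
structural. *)
Fixpoint bounded_patterns h m : seq pattern :=
  if m is m'.+1 then
    if h is h'.+1 then
      flatten [seq joins (bounded_patterns h' k) (bounded_patterns h' (m' - k)%N) (k < m')%N
              | k <- iota 0 m]
    else [::]
  else [:: Leaf].

Lemma bounded_patternsS h m : bounded_patterns h.+1 m.+1 =
  flatten [seq joins (bounded_patterns h k) (bounded_patterns h (m - k)%N) (k < m)%N
          | k <- iota 0 m.+1].
Proof. by []. Qed.

Definition patterns m := bounded_patterns m m.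

Lemma mem_leaf t : (t \in [:: Leaf]) = reduced t && (psize t == 0%N).
Proof.
by rewrite inE; case: eqP => [-> //|]; case: t => //= a fl b _; rewrite addnS andbF.
Qed.

Lemma mem_bounded_patterns h m t : (m <= h)%N ->
  (t \in bounded_patterns h m) = reduced t && (psize t == m).
Proof.
elim: h m t => [|h IH] m t.
  by rewrite leqn0 => /eqP ->; apply: mem_leaf.
case: m => [_|m mh0]; first exact: mem_leaf.
have mh : (m <= h)%N by lia.
rewrite bounded_patternsS; apply/idP/idP.
  case/flatten_mapP => k; rewrite mem_iota => km0; have km : (k <= m)%N by lia.
  have kh : (k <= h)%N by lia.
  have mkh : (m - k <= h)%N by lia.
  rewrite mem_cat => /orP[|].
    case/allpairsP => -[a b] /= []; rewrite !IH// => /andP[ca /eqP sa] /andP[cb /eqP sb] -> /=.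
    by rewrite ca cb /= sa sb; lia.
  case: ltnP => // km'.
  case/allpairsP => -[a b] /= []; rewrite !IH// => /andP[ca /eqP sa] /andP[cb /eqP sb] -> /=.
  by rewrite ca cb /= sa sb; lia.
case: t => [|a fl b]; first by case/andP.
case/andP => red /eqP s0.
have /and3P[ca cb cf] : [&& reduced a, reduced b & fl || (0 < psize b)%N] by exact: red.
have s : (psize a + (psize b).+1 = m.+1)%N by [].
have sa : (psize a <= h)%N by lia.
have sb : (m - psize a <= h)%N by lia.
have ma : a \in bounded_patterns h (psize a) by rewrite IH// ca eqxx.
have mb : b \in bounded_patterns h (m - psize a)%N.
  by rewrite IH// cb; apply/eqP; lia.
apply/flattenP; exists (joins (bounded_patterns h (psize a))
    (bounded_patterns h (m - psize a)%N) (psize a < m)%N).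
  by apply/mapP; exists (psize a) => //; rewrite mem_iota; lia.
rewrite mem_cat; case: fl cf {red s0} => cf; first by apply/orP; left; apply: allpairs_f.
by apply/orP; right; rewrite ifT; [apply: allpairs_f|lia].
Qed.

(** The parts are disjoint because each entry remembers the index of its part. *)
Lemma uniq_flatten_tag (T I : eqType) (g : T -> I) (F : I -> seq T) (s : seq I) :
  uniq s -> (forall k, k \in s -> uniq (F k)) ->
  (forall k x, k \in s -> x \in F k -> g x = k) ->
  uniq (flatten [seq F k | k <- s]).
Proof.
elim: s => //= k s IH /andP[ks us] uF gF; rewrite cat_uniq uF ?mem_head//=.
rewrite IH//; last first.
- by move=> k' x k's; apply: gF; rewrite inE k's orbT.
- by move=> k' k's; apply: uF; rewrite inE k's orbT.
rewrite andbT; apply/hasPn => x /flatten_mapP[k' k's xF]; apply/negP => /= xk.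
have := gF k x (mem_head _ _) xk; rewrite (gF k') ?inE ?k's ?orbT// => E.
by rewrite -E k's in ks.
Qed.

Lemma uniq_bounded_patterns h m : (m <= h)%N -> uniq (bounded_patterns h m).
Proof.
elim: h m => [|h IH] m; first by rewrite leqn0 => /eqP ->.
case: m => [//|m mh0]; have mh : (m <= h)%N by lia.
rewrite bounded_patternsS.
apply: (@uniq_flatten_tag _ _ (fun t => if t is Node a _ _ then psize a else 0%N)).
  exact: iota_uniq.
  move=> k; rewrite mem_iota => km.
  have ua : uniq (bounded_patterns h k) by apply: IH; lia.
  have ub : uniq (bounded_patterns h (m - k)%N) by apply: IH; lia.
  rewrite /joins cat_uniq allpairs_uniq//=; last by move=> [? ?] [? ?] _ _ [-> ->].
  case: ltnP => // _; rewrite allpairs_uniq ?andbT//; last by move=> [? ?] [? ?] _ _ [-> ->].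
  by apply/hasPn => x /allpairsP[[a b] [_ _ ->]]; apply/negP => /allpairsP[[a' b'] [_ _]].
move=> k t; rewrite mem_iota => km.
have ka a : a \in bounded_patterns h k -> psize a = k.
  by rewrite mem_bounded_patterns; [case/andP => _ /eqP|lia].
rewrite mem_cat => /orP[|]; first by case/allpairsP => -[a b] /= [/ka ? _ ->].
by case: ltnP => // _; case/allpairsP => -[a b] /= [/ka ? _ ->].
Qed.

Lemma mem_patterns m t : (t \in patterns m) = reduced t && (psize t == m).
Proof. exact: mem_bounded_patterns. Qed.

Lemma perm_patterns h m : (m <= h)%N -> perm_eq (bounded_patterns h m) (patterns m).
Proof.
move=> mh; apply: uniq_perm; rewrite ?uniq_bounded_patterns// => t.
by rewrite mem_patterns mem_bounded_patterns.
Qed.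

Definition total_weight j m := \sum_(t <- patterns m) weight j t.

Lemma total_weight0 j : total_weight j 0 = f j.
Proof. by rewrite /total_weight /patterns /= big_seq1. Qed.

Lemma total_weightS j m : total_weight j m.+1 =
  \sum_(k < m.+1) total_weight 0 k * (total_weight j.+1 (m - k)%N +
    (k < m)%N%:R * (f j.+1 * total_weight 0 (m - k)%N)).
Proof.
have E j' k : (k <= m)%N -> \sum_(t <- bounded_patterns m k) weight j' t = total_weight j' k.
  by move=> km; apply: perm_big; apply: perm_patterns.
rewrite {1}/total_weight /patterns bounded_patternsS big_flatten big_map.
rewrite -[iota 0 _]/(index_iota 0 m.+1) big_mkord.
apply: eq_bigr => k _; have km : (k <= m)%N by rewrite -ltnS.
rewrite /joins big_cat big_allpairs_dep /= mulrDr; congr (_ + _).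
  by rewrite -!E ?leq_subr// mulr_suml; apply: eq_bigr => a _; rewrite mulr_sumr.
case: ltnP => km'; last by rewrite big_nil mul0r mulr0.
rewrite big_allpairs_dep /= mul1r -!E ?leq_subr// mulr_suml; apply: eq_bigr => a _.
by rewrite !mulr_sumr.
Qed.

End Weights.

Local Open Scope classical_set_scope.

(** * The sum over the faces *)

Section FaceSum.
Variables (R : realType) (n : nat).

(** The empty blocks are discarded, as the blocks of a partition are nonempty. *)
Definition ord_blocks t : seq (seq 'I_n) :=
  [seq pmap insub l | l <- blocks t 0 & l != [::]].

Section OneFace.
Variables (t : pattern) (y : nat -> R).
Hypotheses (st : psize t = n) (yt : models y t 0).

Lemma map_val_ord_block l : l \in blocks t 0 -> map val (pmap insub l : seq 'I_n) = l.
Proof.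
move=> lt; rewrite (pmap_filter (@insubK _ _ _)); apply/all_filterP/allP => i il.
by rewrite isSome_insub -st; case/andP: (mem_blocks lt il).
Qed.

Lemma ord_blocks_partition : ordered_partition (ord_blocks t).
Proof.
apply/andP; split.
  apply/negP => /mapP[l]; rewrite mem_filter => /andP[l0 lt] E.
  by move: l0; rewrite -(map_val_ord_block lt) -E.
apply: (perm_map_inj val_inj); rewrite val_enum_ord map_flatten -map_comp.
rewrite (_ : [seq _ | l <- _] = [seq l <- blocks t 0 | l != [::]]); last first.
  rewrite -[RHS]map_id; apply/eq_in_map => l; rewrite mem_filter => /andP[_ lt].
  exact: map_val_ord_block.
rewrite (_ : flatten _ = flatten (blocks t 0)); first by rewrite -st perm_blocks.
by elim: (blocks t 0) => //= -[|a l] s /= ->.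
Qed.

Lemma ord_blocks_classes : class_blocks y (ord_blocks t).
Proof.
split; first exact: ord_blocks_partition.
  move=> k /mapP[l]; rewrite mem_filter => /andP[_ lt] ->.
  by have := sorted_blocks lt; rewrite -{1}(map_val_ord_block lt) sorted_map.
move=> i j; rewrite -(blocks_dominates yt) ?st ?ltn_ord//.
split=> [[k [/mapP[l lf ->]]]|[l [lt il jl]]].
  by move: lf; rewrite mem_filter => /andP[_ lt]; rewrite !mem_pmap_sub; exists l.
exists (pmap insub l); rewrite !mem_pmap_sub; split=> //; apply/mapP; exists l => //.
by rewrite mem_filter lt andbT; case: (l) il.
Qed.

Lemma face_term_weight (K : fieldType) (c : nat -> K) :
  (-1) ^+ (n - affine_dim (@loday_face R n y)) * face_coef c (@loday_face R n y) =
  weight (fun k => if k == 0%N then 1 else - c k) 0 t.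
Proof.
rewrite (loday_face_term c ord_blocks_classes) weight0_blocks//.
rewrite big_map big_filter big_mkcond big_seq [RHS]big_seq; apply: eq_bigr => l lt /=.
rewrite size_eq0; case: eqP => //= _.
by rewrite -(size_map val) map_val_ord_block.
Qed.

End OneFace.

Definition realization t : nat -> R := xget (fun=> 0) [set y | models y t 0].

Lemma realizationP t : models (realization t) t 0.
Proof. by have [y [my _ _]] := pattern_realizable t 0 (0 : R); exact: (@xgetI _ _ [set y | models y t 0] y my). Qed.

Lemma eq_loday_face_pattern t t' : t \in patterns n -> t' \in patterns n ->
  @loday_face R n (realization t) = @loday_face R n (realization t') -> t = t'.
Proof.
rewrite !mem_patterns => /andP[ct /eqP st] /andP[ct' /eqP st'] /loday_face_eq h.
apply: (pattern_unique ct ct' _ (realizationP t)); first by rewrite st.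
apply: models_transfer (realizationP t') => i j.
rewrite st' => /= ir jr; by have := h (Ordinal ir) (Ordinal jr) => /= ->.
Qed.

Lemma faces_patterns :
  faces (@loday R n) = [set` [seq @loday_face R n (realization t) | t <- patterns n]].
Proof.
apply/seteqP; split=> F.
  move=> /facesE[y ->]; have [t [ct st mt]] := pattern_exists y n 0.
  apply/mapP; exists t; first by rewrite mem_patterns ct st eqxx.
  apply/loday_face_eq => i j.
  by split; apply: (@models_dominates _ _ _ t 0); rewrite ?st ?ltn_ord//; apply: realizationP.
by move=> /mapP[t _ ->]; apply/facesE; exists (realization t).
Qed.

Lemma sum_faces (K : fieldType) (c : nat -> K) :
  \sum_(F \in faces (@loday R n)) (-1) ^+ (n - affine_dim F) * face_coef c F =
  total_weight (fun k => if k == 0%N then 1 else - c k) 0 n.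
Proof.
rewrite faces_patterns -fsbig_seq; last first.
  rewrite map_inj_in_uniq; first exact: uniq_bounded_patterns.
  exact: eq_loday_face_pattern.
rewrite big_map /total_weight big_seq [RHS]big_seq; apply: eq_bigr => t.
rewrite mem_patterns => /andP[_ /eqP st].
exact: face_term_weight st (realizationP t) _ c.
Qed.

End FaceSum.

Theorem theorem11p3 (R : realType) (K : fieldType)
    (charK0 : [pchar K] =i pred0) (c d : nat -> K)
    (d_def : forall n : nat, (1 <= n)%N ->
       d n = \sum_(F \in faces (@loday R n))
               (-1) ^+ (n - affine_dim F) * face_coef c F) :
  compositional_inverse (tangent_series c) (tangent_series d).
Proof.
pose f k : K := if k == 0%N then 1 else - c k.
apply: (@series_inversion K c d f (total_weight f)) => //.
- exact: total_weight0.
- exact: total_weightS.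
- by move=> m m0; rewrite d_def// sum_faces.
Qed.
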